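(* Let $(B,\diamond,\nu)$ be a Zinbiel bialgebra and $(D,\dashv,\vdash,\omega)$ a quadratic diassociative algebra. Let $(D\otimes B,[-,-])$ be the Lie algebra with bracket $$[d_1\otimes b_1,d_2\otimes b_2]=(d_1\vdash d_2)\otimes(b_1\diamond b_2)+(d_1\dashv d_2)\otimes(b_2\diamond b_1)-(d_2\vdash d_1)\otimes(b_2\diamond b_1)-(d_2\dashv d_1)\otimes(b_1\diamond b_2).$$ Define $\delta:D\otimes B\to(D\otimes B)\otimes(D\otimes B)$ by $$\delta(d\otimes b)=\theta_{\vdash,\omega}(d)\bullet\nu(b)+\theta_{\dashv,\omega}(d)\bullet\tau(\nu(b))-\tau(\theta_{\vdash,\omega}(d))\bullet\tau(\nu(b))-\tau(\theta_{\dashv,\omega}(d))\bullet\nu(b).$$ Then $(D\otimes B,[-,-],\delta)$ is a Lie bialgebra. In particular, $(D\otimes B,[-,-],\delta)$ is quasi-triangular (resp. triangular, factorizable) if $(B,\diamond,\nu)$ is quasi-triangular (resp. triangular, factorizable).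
   Context: All vector spaces are finite-dimensional over a field $\Bbbk$ of characteristic zero; $\tau(x\otimes y)=y\otimes x$; $(d'\otimes d'')\bullet(b'\otimes b''):=(d'\otimes b')\otimes(d''\otimes b'')$. For $s\in V\otimes V$, $s^\sharp:V^*\to V$ is defined by $\langle\xi_2,s^\sharp(\xi_1)\rangle=\langle\xi_1\otimes\xi_2,s\rangle$. Zinbiel algebra $(B,\diamond)$: $b_1\diamond(b_2\diamond b_3)=(b_1\diamond b_2)\diamond b_3+(b_2\diamond b_1)\diamond b_3$. Zinbiel coalgebra $(B,\nu)$: $(\mathrm{id}\otimes\nu)\nu=(\nu\otimes\mathrm{id})\nu+(\tau\otimes\mathrm{id})(\nu\otimes\mathrm{id})\nu$. With $\bar{\mathbf l}_B(b)(x)=b\diamond x$, $\bar{\mathbf r}_B(b)(x)=x\diamond b$, a Zinbiel bialgebra $(B,\diamond,\nu)$ is a Zinbiel algebra and coalgebra with $\nu(b_1\diamond b_2)+\nu(b_2\diamond b_1)=(\mathrm{id}\otimes(\bar{\mathbf l}_B+\bar{\mathbf r}_B)(b_2))\nu(b_1)+(\bar{\mathbf l}_B(b_1)\otimes\mathrm{id})\nu(b_2)$ and $\nu(b_1\diamond b_2)+\tau\nu(b_1\diamond b_2)=(\mathrm{id}\otimes\bar{\mathbf r}_B(b_2))\nu(b_1)+(\bar{\mathbf l}_B(b_1)\otimes\mathrm{id})(\nu(b_2)+\tau\nu(b_2))$. For $r\in B\otimes B$: $\nu_r(b)=\big(\bar{\mathbf l}_B(b)\otimes\mathrm{id}-\mathrm{id}\otimes(\bar{\mathbf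 l}_B+\bar{\mathbf r}_B)(b)\big)(r)$. An element $s\in B\otimes B$ is Zinb-invariant if $\big(\bar{\mathbf l}_B(b)\otimes\mathrm{id}-\mathrm{id}\otimes(\bar{\mathbf l}_B+\bar{\mathbf r}_B)(b)\big)(s)=0$ for all $b$. The Zinbiel Yang-Baxter equation (ZYBE) for $r=\sum_i x_i\otimes y_i$ is $\sum_{i,j}\big((x_i\diamond y_j)\otimes x_j\otimes y_i+(y_i\diamond x_j)\otimes x_i\otimes y_j+x_i\otimes(y_i\diamond x_j)\otimes y_j+x_j\otimes(x_i\diamond y_j)\otimes y_i-x_i\otimes x_j\otimes(y_i\diamond y_j)-x_j\otimes x_i\otimes(y_i\diamond y_j)-(x_i\diamond x_j)\otimes y_j\otimes y_i-y_j\otimes(x_i\diamond x_j)\otimes y_i\big)=0$. $(B,\diamond,\nu)$ is quasi-triangular if $\nu=\nu_r$ for some solution $r$ of the ZYBE with $r-\tau(r)$ Zinb-invariant; triangular if $\nu=\nu_r$ for some solution $r$ with $\tau(r)=r$; factorizable if it is quasi-triangular with such an $r$ for which $r^\sharp-\tau(r)^\sharp:B^*\to B$ is a linear isomorphism. Diassociative algebra $(D,\dashv,\vdash)$: two associative products with $(d_1\dashv d_2)\dashv d_3=d_1\dashv(d_2\vdash d_3)$, $(d_1\vdash d_2)\dashv d_3=d_1\vdash(d_2\dashv d_3)$, $(d_1\dashv d_2)\vdash d_3=(d_1\vdash d_2)\vdash d_3$. Quadratic: with a skew-symmetric nondegenerate form $\omega$ such that $\omega(d_1\vdash d_2,d_3)=\omega(d_1,d_2\vdash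 d_3-d_2\dashv d_3)$ and $\omega(d_1\dashv d_2,d_3)=\omega(d_1,d_2\vdash d_3)$. The maps $\theta_{\dashv,\omega},\theta_{\vdash,\omega}:D\to D\otimes D$ are given by $\omega(\theta_{\dashv,\omega}(d_1),d_2\otimes d_3)=\omega(d_1,d_2\dashv d_3)$, $\omega(\theta_{\vdash,\omega}(d_1),d_2\otimes d_3)=\omega(d_1,d_2\vdash d_3)$, where $\omega(a\otimes b,a'\otimes b')=\omega(a,a')\omega(b,b')$. Lie bialgebra $(\mathfrak g,[-,-],\delta)$: a Lie algebra with $\delta:\mathfrak g\to\mathfrak g\otimes\mathfrak g$ such that $\tau\delta=-\delta$, $(\mathrm{id}\otimes\delta)\delta-(\tau\otimes\mathrm{id})(\mathrm{id}\otimes\delta)\delta=(\delta\otimes\mathrm{id})\delta$, and $\delta([g_1,g_2])=(\mathrm{ad}(g_1)\otimes\mathrm{id}+\mathrm{id}\otimes\mathrm{ad}(g_1))\delta(g_2)-(\mathrm{ad}(g_2)\otimes\mathrm{id}+\mathrm{id}\otimes\mathrm{ad}(g_2))\delta(g_1)$. For $s=\sum_i u_i\otimes v_i\in\mathfrak g\otimes\mathfrak g$ let $\delta_s(g)=(\mathrm{id}\otimes\mathrm{ad}(g)+\mathrm{ad}(g)\otimes\mathrm{id})(s)$; $s$ is Lie-invariant if $\delta_s=0$; the CYBE is $\sum_{i,j}\big([u_i,u_j]\otimes v_i\otimes v_j+u_i\otimes u_j\otimes[v_i,v_j]+u_i\otimes[v_i,u_j]\otimes v_j\big)=0$. The Lie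 bialgebra is quasi-triangular if $\delta=\delta_s$ for a solution $s$ of the CYBE with $s+\tau(s)$ Lie-invariant; triangular if $\delta=\delta_s$ for a solution with $\tau(s)=-s$; factorizable if quasi-triangular with such $s$ for which $s^\sharp+\tau(s)^\sharp:\mathfrak g^*\to\mathfrak g$ is a linear isomorphism. *)

(* Defs.v *)
From HB Require Import structures.
From mathcomp Require Import all_boot all_order all_algebra.

Set Implicit Arguments.
Unset Strict Implicit.
Unset Printing Implicit Defensive.

Import GRing.Theory.
Local Open Scope ring_scope.

Reserved Notation "u ⊗ v" (at level 40, left associativity).

(* U ⊗ V is modelled by its coordinate matrices in the bases
   [vbasis fullv] of U and V.  The model is basis-free in effect:
   [tens] is bilinear, its values span, and a bilinear map F factors through
   it as [tlift F] (lemmas [tens_linearl], [tens_linearr], [tens_span] and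
   [tlift_tens] below). *)
Definition tensor (K : fieldType) (U V : vectType K) : Type :=
  'M[K]_(\dim {:U}, \dim {:V}).

HB.instance Definition _ (K : fieldType) (U V : vectType K) :=
  Vector.copy (tensor U V) 'M[K]_(\dim {:U}, \dim {:V}).

Notation "U ⊗ V" := (tensor U%type V%type) : type_scope.

Definition tens (K : fieldType) (U V : vectType K) (u : U) (v : V) : U ⊗ V :=
  \matrix_(i, j) (coord (vbasis fullv) i u * coord (vbasis fullv) j v).

Notation "u ⊗ v" := (tens u v) : ring_scope.

(* For t = \sum_k x_k ⊗ y_k and F bilinear, tlift F t = \sum_k F x_k y_k;
   tlift is only meant to be used with a bilinear F. *)
Definition tlift (K : fieldType) (U V W : vectType K) (F : U -> V -> W)
    (t : U ⊗ V) : W :=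
  \sum_i \sum_j t i j *: F (vbasis {:U})`_i (vbasis {:V})`_j.

Definition tmap (K : fieldType) (U U' V V' : vectType K)
    (f : U -> U') (g : V -> V') (t : U ⊗ V) : U' ⊗ V' :=
  tlift (fun u v => f u ⊗ g v) t.

Definition tau (K : fieldType) (U V : vectType K) (t : U ⊗ V) : V ⊗ U :=
  tlift (fun u v => v ⊗ u) t.

Definition tassoc (K : fieldType) (U V W : vectType K)
    (t : U ⊗ (V ⊗ W)) : U ⊗ V ⊗ W :=
  tlift (fun u t' => tlift (fun v w => u ⊗ v ⊗ w) t') t.

Definition bullet (K : fieldType) (D B : vectType K)
    (t : D ⊗ D) (s : B ⊗ B) : (D ⊗ B) ⊗ (D ⊗ B) :=
  tlift (fun d' d'' => tlift (fun b' b'' => (d' ⊗ b') ⊗ (d'' ⊗ b'')) s) t.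

(* <xi1 ⊗ xi2, t> *)
Definition dual_pairing (K : fieldType) (U V : vectType K)
    (xi1 : 'Hom(U, K^o)) (xi2 : 'Hom(V, K^o)) (t : U ⊗ V) : K :=
  tlift (fun u v => xi1 u * xi2 v : K^o) t.

(* The defining relation <xi2, s^sharp xi1> = <xi1 ⊗ xi2, s> is [sharpP]. *)
Definition sharp (K : fieldType) (V : vectType K) (s : V ⊗ V)
    (xi : 'Hom(V, K^o)) : V :=
  tlift (fun x y => (xi x : K) *: y) s.

Definition linear_iso (K : fieldType) (U V : vectType K) (f : U -> V) : Prop :=
  linear f /\ bijective f.

Section TensorTheory.
Variable K : fieldType.
Implicit Types U V W : vectType K.

Lemma tens_linearl U V (v : V) : linear (fun u : U => u ⊗ v).
Proof.
by move=> a x y; apply/matrixP=> i j; rewrite !mxE linearP /= mulrDl -mulrA.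
Qed.

Lemma tens_linearr U V (u : U) : linear (fun v : V => u ⊗ v).
Proof.
by move=> a x y; apply/matrixP=> i j; rewrite !mxE linearP /= mulrDr mulrCA.
Qed.

Lemma tlift_linear U V W (F : U -> V -> W) : linear (tlift F).
Proof.
move=> a s t; rewrite /tlift scaler_sumr -big_split; apply: eq_bigr => i _ /=.
rewrite scaler_sumr -big_split; apply: eq_bigr => j _ /=.
by rewrite !mxE scalerDl scalerA.
Qed.

HB.instance Definition _ U V W (F : U -> V -> W) :=
  GRing.isLinear.Build K (U ⊗ V)%type W _ (tlift F) (tlift_linear F).

Lemma linear_lincomb U W (f : U -> W) n (c : 'I_n -> K) (x : 'I_n -> U) :
  linear f -> f (\sum_i c i *: x i) = \sum_i c i *: f (x i).
Proof.
move=> lf; pose f' : {linear U -> W} := HB.pack f (GRing.isLinear.Build _ _ _ _ f lf).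
rewrite -[f]/(f' : _ -> _) linear_sum; apply: eq_bigr => i _.
by rewrite linearZ.
Qed.

Lemma tlift_tens U V W (F : U -> V -> W) :
  (forall v, linear (F^~ v)) -> (forall u, linear (F u)) ->
  forall u v, tlift F (u ⊗ v) = F u v.
Proof.
move=> Fl Fr u v; rewrite {2}(coord_vbasis (memvf u)) {2}(coord_vbasis (memvf v)).
rewrite (linear_lincomb _ _ (Fl _)); apply: eq_bigr => i _.
rewrite (linear_lincomb _ _ (Fr _)) scaler_sumr; apply: eq_bigr => j _.
by rewrite mxE scalerA.
Qed.

Lemma tens_span U V (t : U ⊗ V) : t = tlift (fun u v => u ⊗ v) t.
Proof.
apply/matrixP=> i j; rewrite /tlift summxE (bigD1 i) //= summxE (bigD1 j) //=.
have co W (k l : 'I_(\dim {:W})) :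
    coord (vbasis {:W}) k (vbasis {:W})`_l = (k == l)%:R.
  by rewrite coord_free ?(basis_free (vbasisP _)) // eq_sym.
rewrite mxE mxE !co !eqxx !mulr1 big1 => [|l /negPf nl].
  rewrite addr0 big1 ?addr0 // => k /negPf nk; rewrite summxE big1 // => l _.
  by rewrite !mxE !co eq_sym nk mul0r mulr0.
by rewrite !mxE !co [j == l]eq_sym nl !mulr0.
Qed.

Lemma linear_comb4 U W (f1 f2 f3 f4 : U -> W) :
  linear f1 -> linear f2 -> linear f3 -> linear f4 ->
  linear (fun x => f1 x + f2 x - f3 x - f4 x).
Proof.
move=> l1 l2 l3 l4 a x y; rewrite l1 l2 l3 l4 !opprD !scalerDr !scalerN.
rewrite (addrACA _ (f1 y)) (addrACA _ (f1 y + f2 y)).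
by rewrite (addrACA _ (f1 y + f2 y - f3 y)).
Qed.

Lemma linear_tensl U V W (f : W -> U) (v : V) :
  linear f -> linear (fun x => f x ⊗ v).
Proof. by move=> lf a x y; rewrite lf tens_linearl. Qed.

Lemma linear_tensr U V W (f : W -> V) (u : U) :
  linear f -> linear (fun x => u ⊗ f x).
Proof. by move=> lf a x y; rewrite lf tens_linearr. Qed.

Lemma linear_tlift U V W (X : vectType K) (F : X -> U -> V -> W) (t : U ⊗ V) :
  (forall u v, linear (fun x => F x u v)) -> linear (fun x => tlift (F x) t).
Proof.
move=> lF a x y; rewrite /tlift scaler_sumr -big_split /=.
apply: eq_bigr => i _; rewrite scaler_sumr -big_split /=.
by apply: eq_bigr => j _; rewrite lF scalerDr !scalerA mulrC.
Qed.

Lemma bilinearl U V W (m : {bilinear U -> V -> W}) v : linear (m^~ v).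
Proof. by move=> a x y; rewrite linearPl. Qed.

Lemma bilinearr U V W (m : {bilinear U -> V -> W}) u : linear (m u).
Proof. by move=> a x y; rewrite linearPr. Qed.

Lemma sharpP (V : vectType K) (s : V ⊗ V) (xi1 xi2 : 'Hom(V, K^o)) :
  xi2 (sharp s xi1) = dual_pairing xi1 xi2 s.
Proof.
rewrite /sharp /dual_pairing /tlift linear_sum; apply: eq_bigr => i _ /=.
by rewrite linear_sum; apply: eq_bigr => j _ /=; rewrite linearZ /= linearZ.
Qed.

End TensorTheory.

Section Zinbiel.
Variables (K : fieldType) (B : vectType K).
Variables (dia : {bilinear B -> B -> B}) (nu : {linear B -> (B ⊗ B)%type}).
Implicit Types r s : B ⊗ B.

Definition zinbiel_algebra : Prop := forall b1 b2 b3,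
  dia b1 (dia b2 b3) = dia (dia b1 b2) b3 + dia (dia b2 b1) b3.

Definition zinbiel_coalgebra : Prop := forall b,
  tassoc (tmap id nu (nu b)) =
    tmap nu id (nu b) + tmap (@tau K B B) id (tmap nu id (nu b)).

Definition lbar (b x : B) : B := dia b x.
Definition rbar (b x : B) : B := dia x b.

Definition zinbiel_bialgebra : Prop :=
  [/\ zinbiel_algebra,
      zinbiel_coalgebra,
      forall b1 b2, nu (dia b1 b2) + nu (dia b2 b1) =
        tmap id (lbar b2 \+ rbar b2) (nu b1) + tmap (lbar b1) id (nu b2)
    & forall b1 b2, nu (dia b1 b2) + tau (nu (dia b1 b2)) =
        tmap id (rbar b2) (nu b1) + tmap (lbar b1) id (nu b2 + tau (nu b2))].

Definition zinb_cobound r (b : B) : B ⊗ B :=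
  tmap (lbar b) id r - tmap id (lbar b \+ rbar b) r.

Definition zinb_invariant s : Prop := forall b, zinb_cobound s b = 0.

(* r = \sum_i xi ⊗ yi = \sum_j xj ⊗ yj *)
Definition zybe r : Prop :=
  tlift (fun xi yi => tlift (fun xj yj =>
      dia xi yj ⊗ xj ⊗ yi + dia yi xj ⊗ xi ⊗ yj
    + xi ⊗ dia yi xj ⊗ yj + xj ⊗ dia xi yj ⊗ yi
    - xi ⊗ xj ⊗ dia yi yj - xj ⊗ xi ⊗ dia yi yj
    - dia xi xj ⊗ yj ⊗ yi - yj ⊗ dia xi xj ⊗ yi) r) r = 0.

Definition zinb_quasi_triangular_by r : Prop :=
  [/\ nu =1 zinb_cobound r, zybe r & zinb_invariant (r - tau r)].

Definition zinb_quasi_triangular : Prop :=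
  exists r, zinb_quasi_triangular_by r.

Definition zinb_triangular : Prop :=
  exists r, [/\ nu =1 zinb_cobound r, zybe r & tau r = r].

Definition zinb_factorizable : Prop :=
  exists2 r, zinb_quasi_triangular_by r &
    linear_iso (fun xi => sharp r xi - sharp (tau r) xi).

End Zinbiel.

Section Diassociative.
Variables (K : fieldType) (D : vectType K).
(* dl is ⊣ and dr is ⊢ *)
Variables (dl dr : {bilinear D -> D -> D}) (omega : {skew_symmetric D}).

Definition diassociative_algebra : Prop :=
  [/\ associative dl, associative dr,
      forall d1 d2 d3, dl (dl d1 d2) d3 = dl d1 (dr d2 d3),
      forall d1 d2 d3, dl (dr d1 d2) d3 = dr d1 (dl d2 d3)
    & forall d1 d2 d3, dr (dl d1 d2) d3 = dr (dr d1 d2) d3].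

Definition quadratic_diassociative : Prop :=
  [/\ diassociative_algebra,
      nondegenerate omega,
      forall d1 d2 d3, omega (dr d1 d2) d3 = omega d1 (dr d2 d3 - dl d2 d3)
    & forall d1 d2 d3, omega (dl d1 d2) d3 = omega d1 (dr d2 d3)].

Definition tensor_form (s t : D ⊗ D) : K :=
  tlift (fun a b =>
    tlift (fun a' b' => omega a a' * omega b b' : K^o) t : K^o) s.

(* theta is the (unique, see [theta_exists] and [theta_unique]) map
   dual to the product op with respect to omega. *)
Definition is_theta (op : {bilinear D -> D -> D}) (theta : D -> D ⊗ D) : Prop :=
  forall d1 d2 d3, tensor_form (theta d1) (d2 ⊗ d3) = omega d1 (op d2 d3).

End Diassociative.

Section Lie.
Variables (K : fieldType) (g : vectType K).
Variables (br : {bilinear g -> g -> g}) (delta : {linear g -> (g ⊗ g)%type}).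
Implicit Types s : g ⊗ g.

Definition lie_algebra : Prop :=
  (forall x, br x x = 0) /\
  (forall x y z, br x (br y z) + br y (br z x) + br z (br x y) = 0).

(* s |-> (ad x ⊗ id + id ⊗ ad x) s *)
Definition ad2 (x : g) s : g ⊗ g := tmap (br x) id s + tmap id (br x) s.

Definition lie_bialgebra : Prop :=
  [/\ lie_algebra,
      forall x, tau (delta x) = - delta x,
      forall x, tassoc (tmap id delta (delta x))
                - tmap (@tau K g g) id (tassoc (tmap id delta (delta x)))
                = tmap delta id (delta x)
    & forall x y, delta (br x y) = ad2 x (delta y) - ad2 y (delta x)].

Definition lie_cobound s (x : g) : g ⊗ g := ad2 x s.

Definition lie_invariant s : Prop := forall x, lie_cobound s x = 0.

(* s = \sum_i ui ⊗ vi = \sum_j uj ⊗ vj *)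
Definition cybe s : Prop :=
  tlift (fun ui vi => tlift (fun uj vj =>
    br ui uj ⊗ vi ⊗ vj + ui ⊗ uj ⊗ br vi vj + ui ⊗ br vi uj ⊗ vj) s) s = 0.

Definition lie_quasi_triangular_by s : Prop :=
  [/\ delta =1 lie_cobound s, cybe s & lie_invariant (s + tau s)].

Definition lie_quasi_triangular : Prop :=
  exists s, lie_quasi_triangular_by s.

Definition lie_triangular : Prop :=
  exists s, [/\ delta =1 lie_cobound s, cybe s & tau s = - s].

Definition lie_factorizable : Prop :=
  exists2 s, lie_quasi_triangular_by s &
    linear_iso (fun xi => sharp s xi + sharp (tau s) xi).

End Lie.

Section Affinization.
Variables (K : fieldType) (B D : vectType K).

(* Values on d1 ⊗ b1, d2 ⊗ b2: [tensor_bracketE]. *)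
Definition tensor_bracket (dia : {bilinear B -> B -> B})
    (dl dr : {bilinear D -> D -> D}) (t1 t2 : D ⊗ B) : D ⊗ B :=
  tlift (fun d1 b1 => tlift (fun d2 b2 =>
      dr d1 d2 ⊗ dia b1 b2 + dl d1 d2 ⊗ dia b2 b1
    - dr d2 d1 ⊗ dia b2 b1 - dl d2 d1 ⊗ dia b1 b2) t2) t1.

(* Values on d ⊗ b: [tensor_cobracketE]. *)
Definition tensor_cobracket (nu : {linear B -> (B ⊗ B)%type})
    (theta_l theta_r : D -> D ⊗ D) (t : D ⊗ B) : (D ⊗ B) ⊗ (D ⊗ B) :=
  tlift (fun d b =>
      bullet (theta_r d) (nu b) + bullet (theta_l d) (tau (nu b))
    - bullet (tau (theta_r d)) (tau (nu b)) - bullet (tau (theta_l d)) (nu b)) t.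

Lemma tensor_bracket_bilinear dia dl dr :
  bilinear_for *:%R *:%R (tensor_bracket dia dl dr).
Proof.
split=> [t2|t1]; first exact: tlift_linear.
by apply: linear_tlift => d1 b1; apply: tlift_linear.
Qed.

HB.instance Definition _ dia dl dr :=
  bilinear_isBilinear.Build K (D ⊗ B)%type (D ⊗ B)%type (D ⊗ B)%type *:%R *:%R
    (tensor_bracket dia dl dr) (tensor_bracket_bilinear dia dl dr).

HB.instance Definition _ nu theta_l theta_r :=
  GRing.isLinear.Build K (D ⊗ B)%type ((D ⊗ B) ⊗ (D ⊗ B))%type _
    (tensor_cobracket nu theta_l theta_r) (tlift_linear _).

Lemma tensor_bracketE dia dl dr d1 b1 d2 b2 :
  tensor_bracket dia dl dr (d1 ⊗ b1) (d2 ⊗ b2) =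
    dr d1 d2 ⊗ dia b1 b2 + dl d1 d2 ⊗ dia b2 b1
  - dr d2 d1 ⊗ dia b2 b1 - dl d2 d1 ⊗ dia b1 b2.
Proof.
rewrite /tensor_bracket !tlift_tens // => x.
- by apply: linear_comb4; apply: linear_tensl;
    first [exact: bilinearl | exact: bilinearr].
- by apply: linear_comb4; apply: linear_tensr;
    first [exact: bilinearl | exact: bilinearr].
- by apply: linear_tlift => d b; apply: linear_comb4;
    apply: linear_tensl; first [exact: bilinearl | exact: bilinearr].
- by apply: linear_tlift => d b; apply: linear_comb4;
    apply: linear_tensr; first [exact: bilinearl | exact: bilinearr].
Qed.

Lemma tensor_cobracketE nu (theta_l theta_r : {linear D -> (D ⊗ D)%type}) d b :
  tensor_cobracket nu theta_l theta_r (d ⊗ b) =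
    bullet (theta_r d) (nu b) + bullet (theta_l d) (tau (nu b))
  - bullet (tau (theta_r d)) (tau (nu b)) - bullet (tau (theta_l d)) (nu b).
Proof.
have lcomp (U V W : vectType K) (f : V -> W) (h : U -> V) :
    linear f -> linear h -> linear (fun x => f (h x)).
  by move=> lf lh a x y; rewrite lh lf.
have lb1 s : linear (fun t : D ⊗ D => bullet t s : (D ⊗ B) ⊗ (D ⊗ B)).
  exact: tlift_linear.
have lb2 t : linear (fun s : B ⊗ B => bullet t s : (D ⊗ B) ⊗ (D ⊗ B)).
  by apply: linear_tlift => ? ?; apply: tlift_linear.
have lt (V : vectType K) : linear (@tau K V V) by exact: tlift_linear.
have lin (V W : vectType K) (f : {linear V -> W}) : linear f.
  by move=> a y z; rewrite linearP.
rewrite /tensor_cobracket tlift_tens // => x; apply: linear_comb4.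
- exact: (lcomp _ _ _ _ _ (lb1 _) (lin _ _ theta_r)).
- exact: (lcomp _ _ _ _ _ (lb1 _) (lin _ _ theta_l)).
- exact: (lcomp _ _ _ _ _ (lb1 _) (lcomp _ _ _ _ _ (lt D) (lin _ _ theta_r))).
- exact: (lcomp _ _ _ _ _ (lb1 _) (lcomp _ _ _ _ _ (lt D) (lin _ _ theta_l))).
- exact: (lcomp _ _ _ _ _ (lb2 _) (lin _ _ nu)).
- exact: (lcomp _ _ _ _ _ (lb2 _) (lcomp _ _ _ _ _ (lt B) (lin _ _ nu))).
- exact: (lcomp _ _ _ _ _ (lb2 _) (lcomp _ _ _ _ _ (lt B) (lin _ _ nu))).
- exact: (lcomp _ _ _ _ _ (lb2 _) (lin _ _ nu)).
Qed.

End Affinization.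

Section Theta.
Variables (K : fieldType) (D : vectType K) (omega : {skew_symmetric D}).

Let e := vbasis {:D}.
Let n : nat := \dim {:D}.
Let G : 'M[K]_n := \matrix_(i, j) omega e`_i e`_j.

Lemma omega_suml m (c : 'I_m -> K) (x : 'I_m -> D) y :
  omega (\sum_k c k *: x k) y = \sum_k c k * omega (x k) y.
Proof.
by rewrite linear_sumlz; apply: eq_bigr => k _; rewrite linearZl_LR.
Qed.

Lemma omega_sumr m (c : 'I_m -> K) (x : 'I_m -> D) y :
  omega y (\sum_k c k *: x k) = \sum_k c k * omega y (x k).
Proof.
by rewrite linear_sumr; apply: eq_bigr => k _; rewrite linearZr_LR.
Qed.

Lemma gram_unit : nondegenerate omega -> G \in unitmx.
Proof.
move=> nd; rewrite -row_free_unit -kermx_eq0.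
apply/eqP/row_matrixP => i; rewrite row0.
set u := row i _; have uG : u *m G = 0 by rewrite -row_mul mulmx_ker row0.
pose x := \sum_k u 0 k *: e`_k.
have x0 : x = 0.
  apply/eqP; rewrite -memv0 -(eqP nd); apply/mem_orthovP => y _.
  rewrite (coord_vbasis (memvf y)) omega_sumr big1 // => j _.
  rewrite omega_suml; have /matrixP/(_ 0 j) := uG; rewrite !mxE => uGj.
  suff -> : \sum_k u 0 k * omega e`_k e`_j = 0 by rewrite mulr0.
  by rewrite -[RHS]uGj; apply: eq_bigr => k _; rewrite [G _ _]mxE.
apply/rowP => k; rewrite [RHS]mxE.
by move/freeP: (basis_free (vbasisP {:D})) => /(_ (fun k => u 0 k)); apply.
Qed.

Let f i : D := \sum_k invmx G i k *: e`_k.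

Lemma dual_basisP : nondegenerate omega ->
  forall i x, omega (f i) x = coord e i x.
Proof.
move=> nd i x; rewrite {1}(coord_vbasis (memvf x)) omega_sumr (bigD1 i) //=.
have fe (j : 'I_n) : omega (f i) e`_j = (i == j)%:R.
  have /matrixP/(_ i j) := mulVmx (gram_unit nd); rewrite !mxE => <-.
  by rewrite omega_suml; apply: eq_bigr => k _; rewrite [G _ _]mxE.
rewrite fe eqxx mulr1 big1 ?addr0 // => j /negPf nj.
by rewrite fe eq_sym nj mulr0.
Qed.

Lemma tensor_formE a b c d :
  tensor_form omega (a ⊗ b) (c ⊗ d) = omega a c * omega b d.
Proof.
have lm (k : K) (h : D -> K^o) : linear h -> linear (fun x => h x * k : K^o).
  by move=> lh x y z; rewrite lh mulrDl -mulrA.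
have ml (k : K) (h : D -> K^o) : linear h -> linear (fun x => k * h x : K^o).
  by move=> lh x y z; rewrite lh mulrDr mulrCA.
have ol y : linear (fun x => omega x y : K^o) by move=> k u v; rewrite linearPl.
have or x : linear (omega x : D -> K^o) by move=> k u v; rewrite linearPr.
rewrite /tensor_form !tlift_tens // => x.
- by apply: lm; apply: or.
- by apply: ml; apply: or.
- by apply: linear_tlift => u v; apply: lm; apply: ol.
- by apply: linear_tlift => u v; apply: ml; apply: ol.
Qed.

Lemma theta_exists (op : {bilinear D -> D -> D}) : nondegenerate omega ->
  exists theta : {linear D -> (D ⊗ D)%type}, is_theta omega op theta.
Proof.
move=> nd.
pose th d := \sum_(i < n) \sum_(j < n) omega d (op e`_i e`_j) *: (f i ⊗ f j).
have th_lin : linear th.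
  move=> a x y; rewrite /th scaler_sumr -big_split; apply: eq_bigr => i _ /=.
  rewrite scaler_sumr -big_split; apply: eq_bigr => j _ /=.
  by rewrite linearPl scalerDl scalerA.
pose th' : {linear D -> (D ⊗ D)%type} :=
  HB.pack th (GRing.isLinear.Build _ _ _ _ th th_lin).
exists th' => d1 d2 d3.
have -> : tensor_form omega (th' d1) (d2 ⊗ d3) =
    \sum_(i < n) \sum_(j < n) omega d1 (op e`_i e`_j) * (coord e i d2 * coord e j d3).
  have lF : linear (fun s => tensor_form omega s (d2 ⊗ d3) : K^o).
    exact: tlift_linear.
  pose F : {linear (D ⊗ D)%type -> K^o} :=
    HB.pack (fun s => tensor_form omega s (d2 ⊗ d3) : K^o)
      (GRing.isLinear.Build _ _ _ _ _ lF).
  rewrite -[LHS]/(F (th d1)) /th linear_sum; apply: eq_bigr => i _.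
  rewrite linear_sum; apply: eq_bigr => j _; rewrite linearZ /=.
  by rewrite tensor_formE !dual_basisP.
rewrite {2}(coord_vbasis (memvf d2)) {2}(coord_vbasis (memvf d3)).
rewrite (linear_lincomb _ _ (bilinearl op _)) omega_sumr.
apply: eq_bigr => i _; rewrite (linear_lincomb _ _ (bilinearr op _)) omega_sumr.
by rewrite mulr_sumr; apply: eq_bigr => j _; rewrite [RHS]mulrA mulrC.
Qed.

Lemma theta_unique (op : {bilinear D -> D -> D}) (th1 th2 : D -> D ⊗ D) :
  nondegenerate omega ->
  is_theta omega op th1 -> is_theta omega op th2 -> th1 =1 th2.
Proof.
move=> nd th1P th2P d; apply/matrixP => k l.
have fr i j : omega e`_i (f j) = - coord e j e`_i.
  by rewrite hermC expr1 mulN1r /= dual_basisP.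
have co (i j : 'I_n) : coord e i e`_j = (i == j)%:R.
  by rewrite coord_free ?(basis_free (vbasisP _)) // eq_sym.
have fE (t : D ⊗ D) : tensor_form omega t (f k ⊗ f l) = t k l.
  rewrite {1}/tensor_form {1}/tlift (bigD1 k) //= (bigD1 l) //=.
  have tE i j : tlift (fun a' b' => omega e`_i a' * omega e`_j b' : K^o)
      (f k ⊗ f l) = coord e k e`_i * coord e l e`_j.
    rewrite tlift_tens => [|v a x y|u a x y].
    - by rewrite !fr mulrNN.
    - by rewrite linearPr mulrDl -mulrA.
    - by rewrite linearPr mulrDr mulrCA.
  rewrite tE !co !eqxx mulr1 [_ *: _]mulr1 big1 => [|j /negPf nj].
    rewrite addr0 big1 ?addr0 // => i /negPf ni; rewrite big1 // => j _.
    by rewrite tE co eq_sym ni mul0r scaler0.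
  by rewrite tE [coord e l _]co eq_sym nj mulr0 scaler0.
by rewrite -!fE th1P th2P.
Qed.

End Theta.

(* Main.v *)
Require Import Defs.
From HB Require Import structures.
From mathcomp Require Import all_boot all_order all_algebra ring.

Set Implicit Arguments.
Unset Strict Implicit.
Unset Printing Implicit Defensive.

Import GRing.Theory.
Local Open Scope ring_scope.

(** The product [m x y = x ⊢ y - y ⊣ x] makes [D] a Leibniz algebra, and the
    trilinear form [omega x (m y z)] is symmetric in [x] and [z] with vanishing
    cyclic sum.  In terms of [m] the bracket is the usual one on the tensor
    product of a Leibniz and a Zinbiel algebra,
    [[p ⊗ a, q ⊗ b] = m p q ⊗ a b - m q p ⊗ b a].  Under the identification of
    [D ⊗ B^*] with [(D ⊗ B)^*] given by [omega], the cobracket is dual to the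
    same bracket, built from the Zinbiel product on [B^*] dual to [nu]; hence
    the co-Jacobi identity is the Jacobi identity again.  The cocycle condition
    is tested on pairs of forms [omega(-, u) ⊗ xi]: it expands over the six
    right-normed words in [m], and the coefficient of each of them is a
    combination of the two compatibility conditions.  If [nu = nu_r], then
    [delta = delta_s] for [s = kappa • r], where [kappa] is the canonical
    element of [omega]; contracting [s] with a form [omega(-, u) ⊗ xi] gives
    [± u ⊗ r^sharp xi], which reduces the CYBE for [s] to the ZYBE for [r]. *)

(** * Evaluation of linear forms on tensors, and separating families of forms *)

Section Forms.
Variable K : fieldType.
Implicit Types U V W X Y : vectType K.

(** The form f ⊗ g on plain functions, so that composites and forms [ev f g] can again be arguments;
    linearity is supplied where needed as [scalar f]. *)
Definition ev U V (f : U -> K) (g : V -> K) (t : U ⊗ V) : K :=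
  tlift (fun u v => f u * g v : K^o) t.

(* For t = \sum_k x_k ⊗ y_k, [lcontr f t] is \sum_k f(x_k) y_k and
   [rcontr g t] is \sum_k g(y_k) x_k. *)
Definition lcontr U V (f : U -> K) (t : U ⊗ V) : V :=
  tlift (fun u v => f u *: v) t.
Definition rcontr U V (g : V -> K) (t : U ⊗ V) : U :=
  tlift (fun u v => g v *: u) t.

Lemma eq_tlift U V W (F G : U -> V -> W) t :
  (forall u v, F u v = G u v) -> tlift F t = tlift G t.
Proof. by move=> eFG; apply: eq_bigr => i _; apply: eq_bigr => j _; rewrite eFG. Qed.

Lemma tlift_comp U V W W' (F : U -> V -> W) (L : W -> W') t :
  linear L -> L (tlift F t) = tlift (fun u v => L (F u v)) t.
Proof.
move=> lL; pose L' : {linear W -> W'} := HB.pack L (GRing.isLinear.Build _ _ _ _ L lL).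
rewrite -[L]/(L' : _ -> _) linear_sum; apply: eq_bigr => i _.
by rewrite linear_sum; apply: eq_bigr => j _; rewrite linearZ.
Qed.

Lemma scalarD U (f : U -> K) x y : scalar f -> f (x + y) = f x + f y.
Proof. by move=> lf; rewrite -[x]scale1r lf scale1r mul1r. Qed.

Lemma scalar0 U (f : U -> K) : scalar f -> f 0 = 0.
Proof. by move=> lf; apply: (addrI (f 0)); rewrite -scalarD // !addr0. Qed.

Lemma scalar_scale U (f : U -> K) a x : scalar f -> f (a *: x) = a * f x.
Proof. by move=> lf; rewrite -[a *: x]addr0 lf scalar0 // addr0. Qed.

Lemma scalarN U (f : U -> K) x : scalar f -> f (- x) = - f x.
Proof. by move=> lf; rewrite -scaleN1r scalar_scale // mulN1r. Qed.

Lemma scalarB U (f : U -> K) x y : scalar f -> f (x - y) = f x - f y.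
Proof. by move=> lf; rewrite scalarD // scalarN. Qed.

Lemma eq_ev U V (f f' : U -> K) (g g' : V -> K) t :
  f =1 f' -> g =1 g' -> ev f g t = ev f' g' t.
Proof. by move=> ef eg; apply: (eq_tlift (W := K^o)) => u v; rewrite ef eg. Qed.

Lemma ev_scalar U V (f : U -> K) (g : V -> K) : scalar (ev f g).
Proof. by move=> a x y; rewrite /ev (tlift_linear (W := K^o)). Qed.

Lemma ev_tens U V (f : U -> K) (g : V -> K) u v :
  scalar f -> scalar g -> ev f g (u ⊗ v) = f u * g v.
Proof.
move=> lf lg; rewrite /ev tlift_tens // => w a x y.
  by rewrite lf mulrDl -mulrA.
by rewrite lg mulrDr mulrCA.
Qed.

Lemma ev_tlift U V X Y (f : U -> K) (g : V -> K) (F : X -> Y -> U ⊗ V) t :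
  ev f g (tlift F t) = tlift (fun x y => ev f g (F x y) : K^o) t.
Proof. exact: (tlift_comp (W' := K^o)) (ev_scalar f g). Qed.

Lemma ev_tmap U U' V V' (f : U' -> K) (g : V' -> K) (F : U -> U') (G : V -> V') t :
  scalar f -> scalar g -> ev f g (tmap F G t) = ev (f \o F) (g \o G) t.
Proof. by move=> lf lg; rewrite ev_tlift; apply: (eq_tlift (W := K^o)) => u v; rewrite ev_tens. Qed.

Lemma ev_tau U V (f : U -> K) (g : V -> K) t :
  scalar f -> scalar g -> ev g f (tau t) = ev f g t.
Proof.
by move=> lf lg; rewrite ev_tlift; apply: (eq_tlift (W := K^o)) => u v; rewrite ev_tens // mulrC.
Qed.

Lemma scalar_lcontr U V (f : U -> K) (g : V -> K) t :
  scalar g -> g (lcontr f t) = ev f g t.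
Proof.
move=> lg; rewrite /lcontr (tlift_comp (W' := K^o) _ _ lg).
by apply: (eq_tlift (W := K^o)) => u v; rewrite scalar_scale.
Qed.

Lemma scalar_rcontr U V (f : U -> K) (g : V -> K) t :
  scalar f -> f (rcontr g t) = ev f g t.
Proof.
move=> lf; rewrite /rcontr (tlift_comp (W' := K^o) _ _ lf).
by apply: (eq_tlift (W := K^o)) => u v; rewrite scalar_scale // mulrC.
Qed.

Lemma evDl U V (f f' : U -> K) (g : V -> K) t :
  ev (fun x => f x + f' x) g t = ev f g t + ev f' g t.
Proof.
rewrite /ev /tlift -big_split; apply: eq_bigr => i _; rewrite -big_split /=.
by apply: eq_bigr => j _; rewrite mulrDl scalerDr.
Qed.

Lemma evDr U V (f : U -> K) (g g' : V -> K) t :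
  ev f (fun x => g x + g' x) t = ev f g t + ev f g' t.
Proof.
rewrite /ev /tlift -big_split; apply: eq_bigr => i _; rewrite -big_split /=.
by apply: eq_bigr => j _; rewrite mulrDr scalerDr.
Qed.

Lemma evNl U V (f : U -> K) (g : V -> K) t : ev (fun x => - f x) g t = - ev f g t.
Proof.
rewrite /ev /tlift -sumrN; apply: eq_bigr => i _; rewrite -sumrN.
by apply: eq_bigr => j _; rewrite mulNr scalerN.
Qed.

Lemma evNr U V (f : U -> K) (g : V -> K) t : ev f (fun x => - g x) t = - ev f g t.
Proof.
rewrite /ev /tlift -sumrN; apply: eq_bigr => i _; rewrite -sumrN.
by apply: eq_bigr => j _; rewrite mulrN scalerN.
Qed.

Lemma tens_ind U V (P : U ⊗ V -> Prop) :
  P 0 -> (forall a x y, P x -> P y -> P (a *: x + y)) ->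
  (forall u v, P (u ⊗ v)) -> forall t, P t.
Proof.
move=> P0 PD Pt t; rewrite [t]tens_span.
have PDD x y : P x -> P y -> P (x + y) by rewrite -{2}[x]scale1r; apply: PD.
apply: big_ind => // i _; apply: big_ind => // j _.
by rewrite -[_ *: _]addr0; apply: PD.
Qed.

(** Later tensor identities are tested on such a family, which turns them into scalar identities
    within reach of [ring]. *)
Definition separating U (P : (U -> K) -> Prop) : Prop :=
  (forall f, P f -> scalar f) /\ (forall x, (forall f, P f -> f x = 0) -> x = 0).

Lemma coord_scalar U i : scalar (coord (vbasis {:U}) i).
Proof. by move=> a x y; rewrite linearP. Qed.

Lemma ev_coord U V (t : U ⊗ V) i j :
  ev (coord (vbasis {:U}) i) (coord (vbasis {:V}) j) t = t i j.
Proof.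
have co (W : vectType K) (k l : 'I_(\dim {:W})) :
    coord (vbasis {:W}) k (vbasis {:W})`_l = (l == k)%:R.
  by rewrite coord_free ?(basis_free (vbasisP _)).
rewrite /ev /tlift (bigD1 i) //= (bigD1 j) //= !co !eqxx mulr1 [_ *: 1]mulr1.
rewrite big1 => [|l /negPf nl]; last by rewrite co nl mulr0 scaler0.
rewrite addr0 big1 ?addr0 // => k /negPf nk; rewrite big1 // => l _.
by rewrite co nk mul0r scaler0.
Qed.

Lemma separating_scalar U : separating (fun f : U -> K => scalar f).
Proof.
split=> // x x0; rewrite (coord_vbasis (memvf x)) big1 // => i _.
by rewrite x0 ?scale0r //; apply: coord_scalar.
Qed.

(** One leg at a time: for g in Q the contraction of t by g is killed by all of P, hence is 0. So
    for every linear f the contraction of t by f is killed by all of Q, hence is 0; with coordinate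
    forms these are the entries of t. *)
Lemma separating_ev U V (P : (U -> K) -> Prop) (Q : (V -> K) -> Prop) :
  separating P -> separating Q ->
  separating (fun h => exists f g, [/\ P f, Q g & h = ev f g]).
Proof.
move=> [Ps P0] [Qs Q0]; split=> [h [f [g [_ _ ->]]]|t t0]; first exact: ev_scalar.
have r0 g : Q g -> rcontr g t = 0.
  move=> Qg; apply: P0 => f Pf; rewrite scalar_rcontr; last exact: Ps.
  by apply: t0; exists f, g.
have l0 f : scalar f -> lcontr f t = 0.
  move=> lf; apply: Q0 => g Qg; rewrite scalar_lcontr; last exact: Qs.
  by rewrite -scalar_rcontr // r0 // scalar0.
apply/matrixP => i j; rewrite mxE -ev_coord -scalar_lcontr; last exact: coord_scalar.
by rewrite l0 ?linear0 //; apply: coord_scalar.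
Qed.

End Forms.

(** * Forms on D ⊗ B built from [omega] and forms on B *)

Section DualForms.
Variables (K : fieldType) (D B : vectType K) (omega : {skew_symmetric D}).

Lemma omega_skew x y : omega x y = - omega y x.
Proof. by rewrite hermC expr1 mulN1r. Qed.

Lemma omegaDl x y z : omega (x + y) z = omega x z + omega y z.
Proof. by rewrite linearDl. Qed.

Lemma omegaBl x y z : omega (x - y) z = omega x z - omega y z.
Proof. by rewrite linearBl. Qed.

Lemma omegaBr x y z : omega x (y - z) = omega x y - omega x z.
Proof. by rewrite linearB. Qed.

Definition omega_form (u d : D) : K := omega d u.

Lemma omega_form_scalar u : scalar (omega_form u).
Proof. by move=> a x y; rewrite /omega_form linearPl. Qed.

Definition oform (u : D) (xi : B -> K) : (D ⊗ B)%type -> K := ev (omega_form u) xi.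

Lemma oform_scalar u xi : scalar (oform u xi).
Proof. exact: ev_scalar. Qed.

Lemma oform_tens u xi d b : scalar xi -> oform u xi (d ⊗ b) = omega d u * xi b.
Proof. by move=> lxi; rewrite /oform ev_tens //; apply: omega_form_scalar. Qed.

Hypothesis omega_nd : nondegenerate omega.

(** A vector killed by all these forms lies in the radical of [omega]. *)
Lemma separating_omega : separating (fun f => exists u, f = omega_form u).
Proof.
split=> [f [u ->]|x x0]; first exact: omega_form_scalar.
apply/eqP; rewrite -memv0 -(eqP omega_nd); apply/mem_orthovP => y _.
by apply: x0 (omega_form y) _; exists y.
Qed.

Definition oforms (f : (D ⊗ B)%type -> K) : Prop :=
  exists u xi, scalar xi /\ f = oform u xi.

Lemma separating_oforms : separating oforms.
Proof.
have [sc sep] := separating_ev separating_omega (separating_scalar B).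
split=> [f [u [xi [_ ->]]]|x x0]; first exact: oform_scalar.
apply: sep => f [g [xi [[u ->] lxi ->]]]; apply: x0.
by exists u, xi.
Qed.

End DualForms.

(** * The Lie bracket on the tensor product of a Leibniz and a Zinbiel algebra *)

Section LeibnizZinbiel.
Variables (K : fieldType) (D B : vectType K) (omega : {skew_symmetric D}).
Variables (m : {bilinear D -> D -> D}) (dia : {bilinear B -> B -> B}).

Definition leibniz_algebra : Prop :=
  forall x y z, m x (m y z) = m (m x y) z + m y (m x z).

Definition leibniz_bracket
    (br : {bilinear (D ⊗ B)%type -> (D ⊗ B)%type -> (D ⊗ B)%type}) : Prop :=
  forall p a q b, br (p ⊗ a) (q ⊗ b) = m p q ⊗ dia a b - m q p ⊗ dia b a.

Variable br : {bilinear (D ⊗ B)%type -> (D ⊗ B)%type -> (D ⊗ B)%type}.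
Hypothesis brE : leibniz_bracket br.
Hypothesis (omega_nd : nondegenerate omega).

Local Notation phi := (oform omega).

Lemma bracket_formE u xi p a q b : scalar xi ->
  phi u xi (br (p ⊗ a) (q ⊗ b)) =
    omega (m p q) u * xi (dia a b) - omega (m q p) u * xi (dia b a).
Proof.
by move=> lxi; rewrite brE scalarB ?oform_tens //; apply: oform_scalar.
Qed.

Lemma bracket_skew x y : br x y = - br y x.
Proof.
have [sc sep] := separating_oforms B omega_nd.
apply/eqP; rewrite -subr_eq0 opprK; apply/eqP.
elim/(@tens_ind K D B): x => [|a x x' IHx IHx'|p a].
- by rewrite linear0l linear0 addr0.
- by rewrite linearPl linearPr addrACA -scalerDr IHx IHx' scaler0 addr0.
elim/(@tens_ind K D B): y => [|b y y' IHy IHy'|q b].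
- by rewrite linear0l linear0 addr0.
- by rewrite linearPl linearPr addrACA -scalerDr IHy IHy' scaler0 addr0.
by rewrite !brE addrC subrKA subrr.
Qed.

Hypotheses (leib : leibniz_algebra) (zinb : zinbiel_algebra dia).

(** As a rewriting rule this brings every word in [m] to right-normed form. *)
Lemma leibniz_left x y z : m (m x y) z = m x (m y z) - m y (m x z).
Proof. by rewrite leib addrK. Qed.

(** On pure tensors the Leibniz identity makes words in [m] right-normed, the Zinbiel identity makes
    words in [dia] left-normed, and then all terms cancel. *)
Lemma bracket_jacobi x y z : br x (br y z) + br y (br z x) + br z (br x y) = 0.
Proof.
have [sc sep] := separating_oforms B omega_nd.
apply: sep => _ [e [xi [lxi ->]]].
set f := phi e xi; have lf : scalar f by apply: oform_scalar.
have P1 a t t' s : br (a *: t + t') s = a *: br t s + br t' s by rewrite linearPl.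
have P2 a t t' s : br s (a *: t + t') = a *: br s t + br s t' by rewrite linearPr.
have fP a t t' : f (a *: t + t') = a * f t + f t' by rewrite lf.
have b0 s : br 0 s = 0 by rewrite linear0l.
have b0r s : br s 0 = 0 by rewrite linear0r.
rewrite !(scalarD _ _ lf).
elim/(@tens_ind K D B): x => [|c x x' IHx IHx'|p a].
- by rewrite !(b0, b0r) (scalar0 lf) !addr0.
- rewrite !(P1, P2, fP).
  (* The right-hand 0 is replaced by c times one induction hypothesis plus the other. *)
  by rewrite -[RHS](mulr0 c) -IHx -[RHS]addr0 -IHx'; ring.
elim/(@tens_ind K D B): y => [|c y y' IHy IHy'|q b].
- by rewrite !(b0, b0r) (scalar0 lf) !addr0.
- rewrite !(P1, P2, fP).
  by rewrite -[RHS](mulr0 c) -IHy -[RHS]addr0 -IHy'; ring.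
elim/(@tens_ind K D B): z => [|c z z' IHz IHz'|r c].
- by rewrite !(b0, b0r) (scalar0 lf) !addr0.
- rewrite !(P1, P2, fP).
  by rewrite -[RHS](mulr0 c) -IHz -[RHS]addr0 -IHz'; ring.
have fE p1 a1 p2 a2 p3 a3 : f (br (p1 ⊗ a1) (br (p2 ⊗ a2) (p3 ⊗ a3))) =
    omega (m p1 (m p2 p3)) e * xi (dia a1 (dia a2 a3))
    - omega (m (m p2 p3) p1) e * xi (dia (dia a2 a3) a1)
    - omega (m p1 (m p3 p2)) e * xi (dia a1 (dia a3 a2))
    + omega (m (m p3 p2) p1) e * xi (dia (dia a3 a2) a1).
  rewrite (brE p2) linearBr (scalarB _ _ lf) /f !bracket_formE //; ring.
rewrite !fE !leibniz_left !zinb !(omegaBl, scalarD _ _ lxi).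
ring.
Qed.

(** Skew-symmetry gives only 2[x, x] = 0; the characteristic makes 2 invertible. *)
Lemma bracket_lie : [pchar K] =i pred0 -> lie_algebra br.
Proof.
move=> char0; split=> [x|]; last exact: bracket_jacobi.
have /eqP := bracket_skew x x; rewrite -subr_eq0 opprK -mulr2n => /eqP x2.
have n2 : 2%:R != 0 :> K by rewrite (iffLR (pcharf0P K) char0).
apply/eqP; have /eqP := x2; rewrite -scaler_nat scaler_eq0.
by move: n2 => /negPf ->.
Qed.

End LeibnizZinbiel.

(** * The product on forms dual to a comultiplication *)

Section DualProduct.
Variable K : fieldType.

Definition dualmul (V : vectType K) (nu : {linear V -> (V ⊗ V)%type})
    (f g : V -> K) (b : V) : K :=
  ev f g (nu b).

Lemma ev_tassoc (U V W : vectType K) (f : U -> K) (g : V -> K) (h : W -> K) t :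
  scalar f -> scalar g -> scalar h ->
  ev (ev f g) h (tassoc t) = ev f (ev g h) t.
Proof.
move=> lf lg lh; rewrite /tassoc ev_tlift; apply: (eq_tlift (W := K^o)) => u t'.
have lfu : linear (fun z : K^o => f u * z : K^o) by move=> a x y; rewrite mulrDr mulrCA.
rewrite ev_tlift (tlift_comp (W := K^o) _ _ lfu).
apply: (eq_tlift (W := K^o)) => v w.
by rewrite !ev_tens ?mulrA //; apply: ev_scalar.
Qed.

Section Coalgebra.
Variables (V : vectType K) (nu : {linear V -> (V ⊗ V)%type}).
Implicit Types f g h : V -> K.

Lemma dualmul_scalar f g : scalar (dualmul nu f g).
Proof. by move=> a x y; rewrite /dualmul linearP ev_scalar. Qed.

Lemma eq_dualmul f f' g g' : f =1 f' -> g =1 g' -> dualmul nu f g =1 dualmul nu f' g'.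
Proof. by move=> ef eg b; apply: eq_ev. Qed.

Lemma dualmul_tassocl f g h b : scalar f -> scalar g -> scalar h ->
  ev (ev f g) h (tassoc (tmap id nu (nu b))) = dualmul nu f (dualmul nu g h) b.
Proof. by move=> lf lg lh; rewrite ev_tassoc // ev_tmap //; apply: ev_scalar. Qed.

Lemma dualmul_tassocr f g h b : scalar f -> scalar g -> scalar h ->
  ev (ev f g) h (tmap nu id (nu b)) = dualmul nu (dualmul nu f g) h b.
Proof. by move=> lf lg lh; rewrite ev_tmap //; apply: ev_scalar. Qed.

Lemma ev_tmap_tau f g h t : scalar f -> scalar g -> scalar h ->
  ev (ev f g) h (tmap (@tau K V V) id t) = ev (ev g f) h t.
Proof.
move=> lf lg lh; rewrite ev_tmap //; last exact: ev_scalar.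
by apply: eq_ev => // s; apply: ev_tau.
Qed.

(** The coalgebra axiom tested on f, g, h: its transpose is the Zinbiel identity for
    [dualmul nu]. *)
Lemma dualmul_zinbiel f g h : zinbiel_coalgebra nu ->
  scalar f -> scalar g -> scalar h ->
  forall b, dualmul nu f (dualmul nu g h) b =
    dualmul nu (dualmul nu f g) h b + dualmul nu (dualmul nu g f) h b.
Proof.
move=> zc lf lg lh b; rewrite -dualmul_tassocl // zc.
by rewrite (scalarD _ _ (ev_scalar _ _)) ev_tmap_tau // !dualmul_tassocr.
Qed.

Lemma separating_ev3 (P : (V -> K) -> Prop) (t : V ⊗ V ⊗ V) :
  separating P ->
  (forall f g h, P f -> P g -> P h -> ev (ev f g) h t = 0) -> t = 0.
Proof.
move=> sP t0; have [_ sep] := separating_ev (separating_ev sP sP) sP.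
by apply: sep => _ [_ [h [[f [g [Pf Pg ->]]] Ph ->]]]; apply: t0.
Qed.

Lemma separating_ev2 (P : (V -> K) -> Prop) (t : V ⊗ V) :
  separating P -> (forall f g, P f -> P g -> ev f g t = 0) -> t = 0.
Proof.
move=> sP t0; have [_ sep] := separating_ev sP sP.
by apply: sep => _ [f [g [Pf Pg ->]]]; apply: t0.
Qed.

End Coalgebra.
End DualProduct.

(** * Skew-symmetry and co-Jacobi identity of the cobracket *)

Section LieCoalgebra.
Variables (K : fieldType) (D B : vectType K) (omega : {skew_symmetric D}).
Variables (m : {bilinear D -> D -> D}) (nu : {linear B -> (B ⊗ B)%type}).
Variable delta : {linear (D ⊗ B)%type -> ((D ⊗ B) ⊗ (D ⊗ B))%type}.

Local Notation phi := (oform omega).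

(** With u ⊗ xi standing for [phi u xi], the transpose of [delta] has the shape required by
    [leibniz_bracket], with [dualmul nu] as Zinbiel product. *)
Definition leibniz_cobracket : Prop := forall u xi v eta d b,
  scalar xi -> scalar eta ->
  dualmul delta (phi u xi) (phi v eta) (d ⊗ b) =
    omega d (m u v) * dualmul nu xi eta b - omega d (m v u) * dualmul nu eta xi b.

Hypotheses (deltaE : leibniz_cobracket) (omega_nd : nondegenerate omega).

Lemma dualmul_phi u xi v eta : scalar xi -> scalar eta ->
  dualmul delta (phi u xi) (phi v eta) =1
    fun x => phi (m u v) (dualmul nu xi eta) x - phi (m v u) (dualmul nu eta xi) x.
Proof.
move=> lxi leta; elim/(@tens_ind K D B) => [|a x y IHx IHy|d b].
- by rewrite !scalar0 ?subrr //; first [exact: ev_scalar | exact: dualmul_scalar].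
- by rewrite dualmul_scalar !oform_scalar IHx IHy; ring.
by rewrite deltaE // !oform_tens //; apply: dualmul_scalar.
Qed.

Lemma cobracket_skew x : tau (delta x) = - delta x.
Proof.
apply/eqP; rewrite -subr_eq0 opprK; apply/eqP.
apply: (separating_ev2 (separating_oforms B omega_nd)) =>
  _ _ [u [xi [lxi ->]]] [v [eta [leta ->]]].
rewrite (scalarD _ _ (ev_scalar _ _)) ev_tau; try exact: oform_scalar.
by rewrite -!/(dualmul _ _ _ _) !dualmul_phi //; ring.
Qed.

Lemma phiBl u v (xi : B -> K) x : phi (u - v) xi x = phi u xi x - phi v xi x.
Proof.
rewrite /oform -evNl -evDl; apply: eq_ev => // d.
by rewrite /omega_form omegaBr.
Qed.

Hypotheses (leib : leibniz_algebra m) (coz : zinbiel_coalgebra nu).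

Lemma phi_dualmul u xi eta zeta x : scalar xi -> scalar eta -> scalar zeta ->
  phi u (dualmul nu xi (dualmul nu eta zeta)) x =
    phi u (dualmul nu (dualmul nu xi eta) zeta) x +
    phi u (dualmul nu (dualmul nu eta xi) zeta) x.
Proof.
by move=> lxi leta lzeta; rewrite /oform -evDr; apply: eq_ev => // b; apply: dualmul_zinbiel.
Qed.

(** On forms f, g, h this reads [f, [g, h]] - [g, [f, h]] = [[f, g], h] for the transposed bracket,
    and the cancellation is that of [bracket_jacobi]. *)
Lemma cobracket_jacobi x :
  tassoc (tmap id delta (delta x)) - tmap (@tau K _ _) id (tassoc (tmap id delta (delta x)))
    = tmap delta id (delta x).
Proof.
apply/eqP; rewrite -subr_eq0; apply/eqP.
apply: (separating_ev3 (separating_oforms B omega_nd)).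
move=> f g h fP gP hP.
have [lf lg lh] : [/\ scalar f, scalar g & scalar h].
  by move: fP gP hP => [? [? [_ ->]]] [? [? [_ ->]]] [? [? [_ ->]]]; split; apply: oform_scalar.
rewrite !(scalarB _ _ (ev_scalar _ _)) ev_tmap_tau // !dualmul_tassocl // dualmul_tassocr //.
case: fP gP hP => {lf lg lh} [u [xi [lxi ->]]] [v [eta [leta ->]]] [w [zeta [lzeta ->]]].
have expr u1 xi1 u2 xi2 u3 xi3 : scalar xi1 -> scalar xi2 -> scalar xi3 ->
   dualmul delta (phi u1 xi1) (dualmul delta (phi u2 xi2) (phi u3 xi3)) x =
     phi (m u1 (m u2 u3)) (dualmul nu xi1 (dualmul nu xi2 xi3)) x
     - phi (m (m u2 u3) u1) (dualmul nu (dualmul nu xi2 xi3) xi1) x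
     - phi (m u1 (m u3 u2)) (dualmul nu xi1 (dualmul nu xi3 xi2)) x
     + phi (m (m u3 u2) u1) (dualmul nu (dualmul nu xi3 xi2) xi1) x.
  move=> l1 l2 l3.
  rewrite (eq_dualmul _ (fun=> erefl) (dualmul_phi _ _ l2 l3)) {1}/dualmul evDr evNr.
  rewrite -!/(dualmul _ _ _ _) !dualmul_phi //; try exact: dualmul_scalar.
  ring.
(* Skew-symmetry turns the left-nested product into a right-nested one, the only shape that [expr]
   expands. *)
have -> : dualmul delta (dualmul delta (phi u xi) (phi v eta)) (phi w zeta) x =
    - dualmul delta (phi w zeta) (dualmul delta (phi u xi) (phi v eta)) x.
  rewrite {1}/dualmul -ev_tau; try exact: oform_scalar; try exact: dualmul_scalar.
  by rewrite cobracket_skew (scalarN _ (ev_scalar _ _)).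
rewrite !expr // !(leibniz_left leib) !phi_dualmul // !phiBl.
ring.
Qed.

End LieCoalgebra.

(** * Invariance of [omega] and the cocycle condition *)

Section Cocycle.
Variables (K : fieldType) (D B : vectType K) (omega : {skew_symmetric D}).
Variables (m : {bilinear D -> D -> D}) (dia : {bilinear B -> B -> B}).
Variable br : {bilinear (D ⊗ B)%type -> (D ⊗ B)%type -> (D ⊗ B)%type}.

Local Notation phi := (oform omega).

(** Invariance is recorded as two symmetries of the trilinear form [omega x (m y z)]. They leave at
    most two independent values among its six permutations, and they yield the adjoints of left and
    right multiplication. *)
Definition quadratic_leibniz : Prop :=
  [/\ leibniz_algebra m, nondegenerate omega,
      forall x y z, omega x (m y z) = omega z (m y x)
    & forall x y z, omega x (m y z) + omega y (m z x) + omega z (m x y) = 0].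

(** These two are the transposes of [lbar b] and [rbar b]. *)
Definition lform (b : B) (xi : B -> K) (x : B) : K := xi (dia b x).
Definition rform (b : B) (xi : B -> K) (x : B) : K := xi (dia x b).

Lemma lform_scalar b xi : scalar xi -> scalar (lform b xi).
Proof. by move=> lxi a x y; rewrite /lform linearPr lxi. Qed.

Lemma rform_scalar b xi : scalar xi -> scalar (rform b xi).
Proof. by move=> lxi a x y; rewrite /rform linearPl lxi. Qed.

Hypotheses (brE : leibniz_bracket m dia br) (qleib : quadratic_leibniz).

Lemma omega_mulr x y z : omega x (m y z) = omega z (m y x).
Proof. by case: qleib. Qed.

Lemma omega_mull x y z : omega x (m y z) = - (omega y (m z x) + omega y (m x z)).
Proof.
case: qleib => _ _ sym cyc; rewrite (sym y x z); apply/eqP.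
by rewrite -subr_eq0 opprK addrA cyc.
Qed.

Lemma omega_adl x y z : omega (m x y) z = - omega y (m x z).
Proof. by rewrite omega_skew omega_mulr. Qed.

Lemma omega_adr x y z : omega (m y x) z = omega y (m x z) + omega y (m z x).
Proof. by rewrite omega_skew omega_mull opprK. Qed.

(** The transpose of ad(p ⊗ a) on the forms [phi u xi], obtained by moving p across [omega] and a
    across xi. *)
Lemma phi_ad u xi p a x : scalar xi ->
  phi u xi (br (p ⊗ a) x) =
    - phi (m p u) (lform a xi) x - phi (m p u) (rform a xi) x
    - phi (m u p) (rform a xi) x.
Proof.
move=> lxi; elim/(@tens_ind K D B): x => [|c x y IHx IHy|q b].
- by rewrite linear0r !(scalar0 (oform_scalar _ _ _)); ring.
- by rewrite linearPr !oform_scalar IHx IHy; ring.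
rewrite (bracket_formE _ brE) // !oform_tens //; try exact: lform_scalar; try exact: rform_scalar.
by rewrite omega_adl omega_adr /lform /rform; ring.
Qed.

Lemma ev_ad2 u xi v eta p a t : scalar xi -> scalar eta ->
  ev (phi u xi) (phi v eta) (ad2 br (p ⊗ a) t) =
  - ev (phi (m p u) (lform a xi)) (phi v eta) t
  - ev (phi (m p u) (rform a xi)) (phi v eta) t
  - ev (phi (m u p) (rform a xi)) (phi v eta) t
  - ev (phi u xi) (phi (m p v) (lform a eta)) t
  - ev (phi u xi) (phi (m p v) (rform a eta)) t
  - ev (phi u xi) (phi (m v p) (rform a eta)) t.
Proof.
move=> lxi leta; rewrite /ad2 (scalarD _ _ (ev_scalar _ _)).
rewrite !ev_tmap; try exact: oform_scalar.
rewrite (eq_ev t (fun x => phi_ad u p a x lxi) (fun=> erefl)).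
rewrite [X in _ + X](eq_ev t (fun=> erefl) (fun x => phi_ad v p a x leta)).
by rewrite !(evDl, evDr, evNl, evNr) !addrA.
Qed.

Variables (nu : {linear B -> (B ⊗ B)%type}).
Variable delta : {linear (D ⊗ B)%type -> ((D ⊗ B) ⊗ (D ⊗ B))%type}.
Hypotheses (deltaE : leibniz_cobracket omega m nu delta).
Hypothesis bialg : zinbiel_bialgebra dia nu.

Lemma dualmul_compat1 xi eta a b : scalar xi -> scalar eta ->
  dualmul nu xi eta (dia a b) + dualmul nu xi eta (dia b a) =
    dualmul nu xi (lform b eta) a + dualmul nu xi (rform b eta) a
    + dualmul nu (lform a xi) eta b.
Proof.
move=> lxi leta; case: bialg => _ _ /(_ a b) /(congr1 (ev xi eta)) + _.
rewrite !(scalarD _ _ (ev_scalar _ _)) !ev_tmap // => ->.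
congr (_ + _); rewrite -evDr; apply: eq_ev => // x /=.
by rewrite scalarD.
Qed.

Lemma dualmul_compat2 xi eta a b : scalar xi -> scalar eta ->
  dualmul nu xi eta (dia a b) + dualmul nu eta xi (dia a b) =
    dualmul nu xi (rform b eta) a + dualmul nu (lform a xi) eta b
    + dualmul nu eta (lform a xi) b.
Proof.
move=> lxi leta; case: bialg => _ _ _ /(_ a b) /(congr1 (ev xi eta)).
have lx := lform_scalar a lxi.
rewrite !(scalarD _ _ (ev_scalar _ _)) !ev_tmap //.
by rewrite !(scalarD _ _ (ev_scalar _ _)) !ev_tau // addrA.
Qed.

Lemma cobracket_cocycle_tens p a q b :
  delta (br (p ⊗ a) (q ⊗ b)) =
    ad2 br (p ⊗ a) (delta (q ⊗ b)) - ad2 br (q ⊗ b) (delta (p ⊗ a)).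
Proof.
have [leib omega_nd _ _] := qleib.
apply/eqP; rewrite -subr_eq0; apply/eqP.
apply: (separating_ev2 (separating_oforms B omega_nd)) =>
  _ _ [u [xi [lxi ->]]] [v [eta [leta ->]]].
rewrite !(scalarB _ _ (ev_scalar _ _)) !ev_ad2 // -!/(dualmul _ _ _ _).
rewrite (dualmul_phi deltaE) // !(bracket_formE _ brE) //; try exact: dualmul_scalar.
have [lla lra llb lrb] : [/\ scalar (lform a xi), scalar (rform a xi),
    scalar (lform b xi) & scalar (rform b xi)].
  by split; first [exact: lform_scalar | exact: rform_scalar].
have [lla' lra' llb' lrb'] : [/\ scalar (lform a eta), scalar (rform a eta),
    scalar (lform b eta) & scalar (rform b eta)].
  by split; first [exact: lform_scalar | exact: rform_scalar].
rewrite !deltaE //.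
(* Goal: every term of the form [omega q (word in p, u, v)]. Where p is outside, it changes places
   with the factor containing q; then the multiplication is taken off q by adjunction, and the words
   are made right-normed. *)
have pl Y z : omega p (m z Y) = omega Y (m z p) by apply: omega_mulr.
have pr Y z : omega p (m Y z) = - (omega Y (m z p) + omega Y (m p z)) by apply: omega_mull.
rewrite !(pl (m q u), pl (m u q), pl (m q v), pl (m v q)).
rewrite !(pr (m q u), pr (m u q), pr (m q v), pr (m v q)).
have ql := omega_adl _ q; have qr := fun x => omega_adr x q.
rewrite !(ql, qr).
rewrite !(leibniz_left leib) !omegaBr.
(* [d1] and [d2] are the defects of the two compatibility conditions, tested on xi and eta. *)
pose d1 xi eta a b := dualmul nu xi eta (dia a b) + dualmul nu xi eta (dia b a)
  - (dualmul nu xi (lform b eta) a + dualmul nu xi (rform b eta) a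
     + dualmul nu (lform a xi) eta b).
pose d2 xi eta a b := dualmul nu xi eta (dia a b) + dualmul nu eta xi (dia a b)
  - (dualmul nu xi (rform b eta) a + dualmul nu (lform a xi) eta b
     + dualmul nu eta (lform a xi) b).
have d10 xi1 eta1 a1 b1 : scalar xi1 -> scalar eta1 -> d1 xi1 eta1 a1 b1 = 0.
  by move=> l1 l2; rewrite /d1 dualmul_compat1 // subrr.
have d20 xi1 eta1 a1 b1 : scalar xi1 -> scalar eta1 -> d2 xi1 eta1 a1 b1 = 0.
  by move=> l1 l2; rewrite /d2 dualmul_compat2 // subrr.
(* The coefficients were found by eliminating the products of [nu] in each of
   the six right-normed words separately. *)
transitivity (
  - omega q (m p (m u v)) * d1 xi eta a b
  + omega q (m p (m v u)) * d1 eta xi a b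
  + omega q (m u (m p v)) * (d1 xi eta a b - d1 xi eta b a)
  - omega q (m u (m v p)) * d2 xi eta b a
  + omega q (m v (m p u)) * (d1 eta xi b a - d1 eta xi a b)
  + omega q (m v (m u p)) * (d1 xi eta a b - d2 xi eta a b + d1 eta xi b a)).
  by rewrite /d1 /d2; ring.
by rewrite !d10 // !d20 //; ring.
Qed.

Lemma cobracket_cocycle x y :
  delta (br x y) = ad2 br x (delta y) - ad2 br y (delta x).
Proof.
have ad2r z : linear (ad2 br z).
  by move=> c t t'; rewrite /ad2 /tmap !tlift_linear scalerDr addrACA.
have ad2l t c z z' : ad2 br (c *: z + z') t = c *: ad2 br z t + ad2 br z' t.
  have l1 : linear (fun w => tmap (br w) id t).
    by apply: linear_tlift => s s' d w w'; rewrite linearPl tens_linearl.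
  have l2 : linear (fun w => tmap id (br w) t).
    by apply: linear_tlift => s s' d w w'; rewrite linearPl tens_linearr.
  by rewrite /ad2 l1 l2 scalerDr addrACA.
have ad20 t : ad2 br 0 t = 0.
  by have := ad2l t (-1) 0 0; rewrite !scaleN1r oppr0 addNr addr0.
have ad20r z : ad2 br z 0 = 0.
  by have := ad2r z (-1) 0 0; rewrite !scaleN1r oppr0 addNr addr0.
elim/(@tens_ind K D B): x => [|c x x' IHx IHx'|p a].
- by rewrite linear0l !linear0 ad20 ad20r subrr.
- by rewrite linearPl !linearP IHx IHx' ad2l ad2r scalerBr addrACA -opprD.
elim/(@tens_ind K D B): y => [|c y y' IHy IHy'|q b].
- by rewrite linear0r !linear0 ad20 ad20r subrr.
- by rewrite linearPr !linearP IHy IHy' ad2l ad2r scalerBr addrACA -opprD.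
exact: cobracket_cocycle_tens.
Qed.

End Cocycle.

(** * Evaluating and contracting the product [bullet] *)

Section Bullet.
Variables (K : fieldType) (D B : vectType K).

Lemma ev_bullet (f g : D -> K) (xi eta : B -> K) t s :
  scalar f -> scalar g -> scalar xi -> scalar eta ->
  ev (ev f xi) (ev g eta) (bullet t s) = ev f g t * ev xi eta s.
Proof.
move=> lf lg lxi leta; rewrite /bullet ev_tlift [in RHS]mulrC.
have lm (c : K) : linear (fun z : K^o => c * z : K^o).
  by move=> a x y; rewrite mulrDr mulrCA.
rewrite -[ev f g t]/(tlift (fun u v => f u * g v : K^o) t).
rewrite (tlift_comp (W := K^o) _ _ (lm _)).
apply: (eq_tlift (W := K^o)) => d d'; rewrite ev_tlift mulrC.
rewrite -[ev xi eta s]/(tlift (fun u v => xi u * eta v : K^o) s).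
rewrite (tlift_comp (W := K^o) _ _ (lm _)).
apply: (eq_tlift (W := K^o)) => b b'.
by rewrite !ev_tens //; try exact: ev_scalar; rewrite mulrACA.
Qed.

Lemma bullet0 (t : D ⊗ D) : bullet t (0 : B ⊗ B) = 0.
Proof.
rewrite /bullet /tlift big1 // => i _; rewrite big1 // => j _.
rewrite [X in _ *: X]big1 ?scaler0 // => k _; rewrite big1 // => l _.
by rewrite mxE scale0r.
Qed.

(** Used from right to left: a bilinear expression in two contractions becomes a double sum, which
    can be compared term by term with a Yang-Baxter expression. *)
Lemma bilin_tlift (U V U' V' X Y : vectType K) (beta : X -> Y -> K)
    (F : U -> V -> X) (G : U' -> V' -> Y) s t :
  (forall x, scalar (beta x)) -> (forall y, scalar (beta^~ y)) ->
  tlift (fun u v => tlift (fun u' v' => beta (F u v) (G u' v') : K^o) t : K^o) s =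
    beta (tlift F s) (tlift G t).
Proof.
move=> lr ll; rewrite (tlift_comp (W' := K^o) _ _ (ll _)).
apply: (eq_tlift (W := K^o)) => u v.
by rewrite (tlift_comp (W' := K^o) _ _ (lr _)).
Qed.

Lemma tliftD (U V W : vectType K) (F G : U -> V -> W) t :
  tlift (fun u v => F u v + G u v) t = tlift F t + tlift G t.
Proof.
rewrite /tlift -big_split; apply: eq_bigr => i _ /=; rewrite -big_split.
by apply: eq_bigr => j _ /=; rewrite scalerDr.
Qed.

Lemma tliftN (U V W : vectType K) (F : U -> V -> W) t :
  tlift (fun u v => - F u v) t = - tlift F t.
Proof.
rewrite /tlift -sumrN; apply: eq_bigr => i _ /=; rewrite -sumrN.
by apply: eq_bigr => j _ /=; rewrite scalerN.
Qed.

Lemma lcontr_tau (U V : vectType K) (f : V -> K) (t : U ⊗ V) :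
  scalar f -> lcontr f (tau t) = rcontr f t.
Proof.
move=> lf; have [_ sep] := separating_scalar U.
apply/eqP; rewrite -subr_eq0; apply/eqP; apply: sep => g lg.
by rewrite scalarB // scalar_lcontr // scalar_rcontr // ev_tau // subrr.
Qed.

Lemma rcontr_tau (U V : vectType K) (f : U -> K) (t : U ⊗ V) :
  scalar f -> rcontr f (tau t) = lcontr f t.
Proof.
move=> lf; have [_ sep] := separating_scalar V.
apply/eqP; rewrite -subr_eq0; apply/eqP; apply: sep => g lg.
by rewrite scalarB // scalar_lcontr // scalar_rcontr // ev_tau // subrr.
Qed.

End Bullet.

(** * The canonical element of [omega] *)

Section Casimir.
Variables (K : fieldType) (D B : vectType K) (omega : {skew_symmetric D}).

Local Notation phi := (oform omega).

(** The element inverse to [omega], described by its pairings. The order of v and u on the right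
    fixes its sign; as [omega] is skew, so are these pairings. *)
Definition casimir (kappa : D ⊗ D) : Prop :=
  forall u v, ev (omega_form omega u) (omega_form omega v) kappa = omega v u.

Lemma casimir_exists : nondegenerate omega -> exists kappa, casimir kappa.
Proof.
move=> nd; have [f fP] : exists f : 'I_(\dim {:D}) -> D,
    forall i x, omega (f i) x = coord (vbasis {:D}) i x.
  by eexists => i x; apply: dual_basisP.
(* The basis is paired with its dual basis for [omega], normalized by [omega (f i) e_j] = 1 if i = j
   and 0 otherwise. *)
exists (\sum_(i < \dim {:D}) (vbasis {:D})`_i ⊗ f i) => u v.
have evs : linear (ev (omega_form omega u) (omega_form omega v) : _ -> K^o).
  exact: ev_scalar.
have := linear_lincomb (fun=> 1) (fun i : 'I_(\dim {:D}) => (vbasis {:D})`_i ⊗ f i) evs.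
under eq_bigr do rewrite scale1r.
move=> ->.
rewrite {2}(coord_vbasis (memvf v)) omega_suml; apply: eq_bigr => i _.
rewrite [_ *: _]mul1r ev_tens; try exact: omega_form_scalar.
by rewrite /omega_form fP mulrC.
Qed.

Hypothesis omega_nd : nondegenerate omega.
Variable kappa : D ⊗ D.
Hypothesis kappaP : casimir kappa.

Lemma ev_casimir u xi v eta (t : B ⊗ B) : scalar xi -> scalar eta ->
  ev (phi u xi) (phi v eta) (bullet kappa t) = omega v u * ev xi eta t.
Proof.
move=> lxi leta; rewrite -kappaP -ev_bullet //; exact: omega_form_scalar.
Qed.

Lemma rcontr_casimir v eta (t : B ⊗ B) : scalar eta ->
  rcontr (phi v eta) (bullet kappa t) = v ⊗ rcontr eta t.
Proof.
move=> leta; have [_ sep] := separating_oforms B omega_nd.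
apply/eqP; rewrite -subr_eq0; apply/eqP; apply: sep => _ [u [xi [lxi ->]]].
rewrite (scalarB _ _ (oform_scalar _ _ _)) scalar_rcontr; last exact: oform_scalar.
by rewrite ev_casimir // oform_tens // scalar_rcontr // subrr.
Qed.

Lemma lcontr_casimir u xi (t : B ⊗ B) : scalar xi ->
  lcontr (phi u xi) (bullet kappa t) = - u ⊗ lcontr xi t.
Proof.
move=> lxi; have [_ sep] := separating_oforms B omega_nd.
apply/eqP; rewrite -subr_eq0; apply/eqP; apply: sep => _ [v [eta [leta ->]]].
rewrite (scalarB _ _ (oform_scalar _ _ _)) scalar_lcontr; last exact: oform_scalar.
rewrite ev_casimir // oform_tens // scalar_lcontr // [omega v u]omega_skew.
by rewrite linearNl subrr.
Qed.

(** Since [kappa] is skew, the flip of [bullet kappa t] is minus [bullet kappa (tau t)]. Thus the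
    condition on r - tau r on the Zinbiel side matches the one on s + tau s on the Lie side. *)
Lemma casimir_skew (t : B ⊗ B) :
  bullet kappa t + tau (bullet kappa t) = bullet kappa (t - tau t).
Proof.
apply/eqP; rewrite -subr_eq0; apply/eqP.
apply: (separating_ev2 (separating_oforms B omega_nd)) =>
  _ _ [u [xi [lxi ->]]] [v [eta [leta ->]]].
rewrite (scalarB _ _ (ev_scalar _ _)) (scalarD _ _ (ev_scalar _ _)).
rewrite ev_tau; try exact: oform_scalar.
rewrite !ev_casimir // (scalarB _ _ (ev_scalar _ _)) ev_tau // [omega u v]omega_skew.
by ring.
Qed.

End Casimir.

(** * The Zinbiel Yang-Baxter equation in terms of contractions of r *)

Section ZinbielYangBaxter.
Variables (K : fieldType) (B : vectType K).
Variable (dia : {bilinear B -> B -> B}).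
Implicit Types xi eta zeta alpha beta : B -> K.

Lemma ev_zinb_cobound (t : B ⊗ B) b xi eta : scalar xi -> scalar eta ->
  ev xi eta (zinb_cobound dia t b) =
    ev (lform dia b xi) eta t - ev xi (lform dia b eta) t - ev xi (rform dia b eta) t.
Proof.
move=> lxi leta; rewrite /zinb_cobound (scalarB _ _ (ev_scalar _ _)) !ev_tmap //.
rewrite -[RHS]addrA -opprD -evDr; congr (_ - _); apply: eq_ev => // x /=.
by rewrite scalarD.
Qed.

Lemma rcontr_linear (U V : vectType K) (f : V -> K) : linear (@rcontr K U V f).
Proof. exact: tlift_linear. Qed.

Lemma lcontr_linear (U V : vectType K) (f : U -> K) : linear (@lcontr K U V f).
Proof. exact: tlift_linear. Qed.

Lemma lcontrD (U V : vectType K) (f : U -> K) (s t : U ⊗ V) :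
  lcontr f (s + t) = lcontr f s + lcontr f t.
Proof. by rewrite -{1}[s]scale1r lcontr_linear scale1r. Qed.

Lemma lcontrB (U V : vectType K) (f : U -> K) (s t : U ⊗ V) :
  lcontr f (s - t) = lcontr f s - lcontr f t.
Proof. by rewrite -scaleN1r addrC lcontr_linear scaleN1r addrC. Qed.

Lemma rcontrB (U V : vectType K) (f : V -> K) (s t : U ⊗ V) :
  rcontr f (s - t) = rcontr f s - rcontr f t.
Proof. by rewrite -scaleN1r addrC rcontr_linear scaleN1r addrC. Qed.

Variable r : B ⊗ B.
Hypothesis inv : zinb_invariant dia (r - tau r).

Local Notation R xi := (rcontr xi r).
Local Notation L xi := (lcontr xi r).

Lemma invariant_ev b xi eta : scalar xi -> scalar eta ->
  ev (lform dia b xi) eta (r - tau r) =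
    ev xi (lform dia b eta) (r - tau r) + ev xi (rform dia b eta) (r - tau r).
Proof.
move=> lxi leta; apply/eqP; rewrite -subr_eq0 opprD addrA -ev_zinb_cobound // inv.
by rewrite (scalar0 (ev_scalar _ _)).
Qed.

Lemma ev_skew xi eta : scalar xi -> scalar eta ->
  ev xi eta (r - tau r) = - ev eta xi (r - tau r).
Proof.
move=> lxi leta; rewrite !(scalarB _ _ (ev_scalar _ _)) !ev_tau //; ring.
Qed.

(** [R xi - L xi] is the contraction of the skew tensor r - tau r by xi, so this is invariance read
    on the pair alpha, beta. The element b stays free, to be replaced later by contractions of r. *)
Lemma invariant_contr alpha beta b : scalar alpha -> scalar beta ->
  alpha (dia b (R beta - L beta)) + beta (dia b (R alpha - L alpha))
    + beta (dia (R alpha - L alpha) b) = 0.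
Proof.
move=> la lb.
have SE xi : scalar xi -> R xi - L xi = rcontr xi (r - tau r).
  by move=> lxi; rewrite rcontrB rcontr_tau.
rewrite !SE //.
rewrite -[alpha _]/(lform dia b alpha _) -[beta (dia b _)]/(lform dia b beta _).
rewrite -[beta (dia _ b)]/(rform dia b beta _) !scalar_rcontr;
  try exact: lform_scalar; try exact: rform_scalar.
rewrite invariant_ev // ![ev alpha _ _]ev_skew //;
  try exact: lform_scalar; try exact: rform_scalar.
by ring.
Qed.

Lemma ev_zybe xi eta zeta : scalar xi -> scalar eta -> scalar zeta ->
  zybe dia r ->
  xi (dia (R zeta) (L eta)) + xi (dia (L eta) (R zeta))
  + eta (dia (L xi) (R zeta)) + eta (dia (R zeta) (L xi))
  - zeta (dia (L xi) (L eta)) - zeta (dia (L eta) (L xi))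
  - xi (dia (R zeta) (R eta)) - eta (dia (R zeta) (R xi)) = 0.
Proof.
move=> lxi leta lzeta /(congr1 (ev (ev xi eta) zeta)).
rewrite (scalar0 (ev_scalar _ _)) ev_tlift => <-.
have bl (al : B -> K) : scalar al -> forall z : B, scalar (fun y => al (dia z y)).
  by move=> lal z a x y; rewrite linearPr lal.
have br (al : B -> K) : scalar al -> forall z : B, scalar (fun y => al (dia y z)).
  by move=> lal z a x y; rewrite linearPl lal.
rewrite -!(bilin_tlift _ _ _ _ (bl _ lxi) (br _ lxi)).
rewrite -!(bilin_tlift _ _ _ _ (bl _ leta) (br _ leta)).
rewrite -!(bilin_tlift _ _ _ _ (bl _ lzeta) (br _ lzeta)).
rewrite -!(tliftN (W := K^o)) -!(tliftD (W := K^o)).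
apply: (eq_tlift (W := K^o)) => xi1 yi1; rewrite ev_tlift.
rewrite -!(tliftN (W := K^o)) -!(tliftD (W := K^o)).
apply: (eq_tlift (W := K^o)) => xj yj.
rewrite !(scalarB _ _ (ev_scalar _ _)) !(scalarD _ _ (ev_scalar _ _)).
rewrite !ev_tens //; try exact: ev_scalar.
rewrite !(linearZl_LR, linearZr_LR)
  !(scalar_scale _ _ lxi, scalar_scale _ _ leta, scalar_scale _ _ lzeta).
ring.
Qed.

Hypothesis zybe_r : zybe dia r.

(** Adding invariance at b = [R zeta] cancels five of the eight terms of the ZYBE and brings in one.
    This will be the coefficient of [omega u (m v w)] in the CYBE. *)
Lemma zybe_reduced xi eta zeta : scalar xi -> scalar eta -> scalar zeta ->
  zeta (dia (L eta) (L xi)) + zeta (dia (L xi) (L eta)) =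
    xi (dia (R eta) (R zeta)) + eta (dia (L xi) (R zeta)).
Proof.
move=> lxi leta lzeta; have e1 := ev_zybe lxi leta lzeta zybe_r.
have := invariant_contr (R zeta) leta lxi.
rewrite !(linearBr, linearBl) /= !(scalarB _ _ lxi) !(scalarB _ _ leta) => e2.
have lin (y a b : K) : a = 0 -> b = 0 -> y = - a - b -> y = 0.
  by move=> -> -> ->; rewrite oppr0 addr0.
apply/eqP; rewrite -subr_eq0; apply/eqP.
by apply: (lin _ _ _ e1 e2); ring.
Qed.

(** The companion identity, for the coefficient of [omega u (m w v)]: the reduced equation for (xi,
    eta, zeta) plus that for (zeta, eta, xi), corrected by five instances of invariance. *)
Lemma zybe_reduced_swap xi eta zeta : scalar xi -> scalar eta -> scalar zeta ->
  xi (dia (R zeta) (R eta)) + zeta (dia (L xi) (L eta)) =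
    eta (dia (R zeta) (L xi)) + eta (dia (L xi) (R zeta)).
Proof.
move=> lxi leta lzeta.
have /eqP := zybe_reduced lxi leta lzeta; rewrite -subr_eq0 => /eqP e1.
have /eqP := zybe_reduced lzeta leta lxi; rewrite -subr_eq0 => /eqP e2.
have := invariant_contr (R eta - L eta) lzeta lxi.
have := invariant_contr (L xi) lzeta leta.
have := invariant_contr (L xi) leta lzeta.
have := invariant_contr (L eta) lzeta lxi.
have := invariant_contr (L zeta) leta lxi.
rewrite !(linearBr, linearBl) /= !(scalarB _ _ lxi, scalarB _ _ leta, scalarB _ _ lzeta).
move=> i1 i2 i3 i4 i5.
have lin (y a b a1 a2 a3 a4 a5 : K) : a = 0 -> b = 0 ->
    a1 = 0 -> a2 = 0 -> a3 = 0 -> a4 = 0 -> a5 = 0 ->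
    y = a + b + a1 + a2 + a3 - a4 + a5 -> y = 0.
  by move=> -> -> -> -> -> -> -> ->; rewrite subr0 !addr0.
apply/eqP; rewrite -subr_eq0; apply/eqP.
apply: (lin _ _ _ _ _ _ _ _ e1 e2 i1 i2 i3 i4 i5); ring.
Qed.


End ZinbielYangBaxter.

(** * The classical r-matrix [bullet kappa r] *)

Section RMatrix.
Variables (K : fieldType) (D B : vectType K) (omega : {skew_symmetric D}).
Variables (m : {bilinear D -> D -> D}) (dia : {bilinear B -> B -> B}).
Variable br : {bilinear (D ⊗ B)%type -> (D ⊗ B)%type -> (D ⊗ B)%type}.

Local Notation phi := (oform omega).

Hypotheses (brE : leibniz_bracket m dia br) (qleib : quadratic_leibniz omega m).
Variable kappa : D ⊗ D.
Hypothesis kappaP : casimir omega kappa.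

(** The two coefficients are the Zinbiel coboundary of t tested on (xi, eta) and that of tau t
    tested on (eta, xi). *)
Lemma ev_ad2_casimir u xi v eta d b (t : B ⊗ B) : scalar xi -> scalar eta ->
  ev (phi u xi) (phi v eta) (ad2 br (d ⊗ b) (bullet kappa t)) =
    omega d (m u v) * (ev (lform dia b xi) eta t
      - ev xi (lform dia b eta) t - ev xi (rform dia b eta) t)
    - omega d (m v u) * (ev xi (lform dia b eta) t
      - ev (lform dia b xi) eta t - ev (rform dia b xi) eta t).
Proof.
move=> lxi leta; rewrite (ev_ad2 brE) // !(ev_casimir kappaP) //;
  try exact: lform_scalar; try exact: rform_scalar.
rewrite !(omega_adl qleib d) !(omega_adr qleib d).
rewrite !(omega_mulr qleib _ _ d) !(omega_mull qleib v d).
by ring.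
Qed.

Lemma tensor_ext (W : vectType K) (F G : (D ⊗ B)%type -> W) :
  linear F -> linear G -> (forall d b, F (d ⊗ b) = G (d ⊗ b)) -> F =1 G.
Proof.
move=> lF lG FG; elim/(@tens_ind K D B) => [|c x y IHx IHy|d b //].
  have z (H : (D ⊗ B)%type -> W) : linear H -> H 0 = 0.
    by move=> lH; have := lH (-1) 0 0; rewrite !scaleN1r oppr0 addr0 addNr.
  by rewrite !z.
by rewrite lF lG IHx IHy.
Qed.

Lemma ad2_linearl t : linear (fun x => ad2 br x t).
Proof.
move=> c z z'.
have l1 : linear (fun w => tmap (br w) id t).
  by apply: linear_tlift => s s' d w w'; rewrite linearPl tens_linearl.
have l2 : linear (fun w => tmap id (br w) t).
  by apply: linear_tlift => s s' d w w'; rewrite linearPl tens_linearr.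
by rewrite /ad2 l1 l2 scalerDr addrACA.
Qed.

Variables (nu : {linear B -> (B ⊗ B)%type}).
Variable delta : {linear (D ⊗ B)%type -> ((D ⊗ B) ⊗ (D ⊗ B))%type}.
Hypotheses (deltaE : leibniz_cobracket omega m nu delta).

Variable r : B ⊗ B.
Hypothesis inv : zinb_invariant dia (r - tau r).
Let s := bullet kappa r : (D ⊗ B) ⊗ (D ⊗ B).

Lemma casimir_invariant : lie_invariant br (s + tau s).
Proof.
have [_ nd _ _] := qleib.
rewrite /s (casimir_skew nd kappaP).
apply: (tensor_ext (ad2_linearl _) (G := fun=> 0)) => [a x y|d b].
  by rewrite scaler0 addr0.
apply: (separating_ev2 (separating_oforms B nd)) =>
  _ _ [u [xi [lxi ->]]] [v [eta [leta ->]]].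
have lx := lform_scalar dia b lxi; have rx := rform_scalar dia b lxi.
have e1 := invariant_ev inv b lxi leta.
have e2 := invariant_ev inv b leta lxi.
(* Skewness of r - tau r brings [e2] to the order of forms found in the coefficient of
   [omega d (m v u)]. *)
rewrite (ev_skew r (lform_scalar dia b leta) lxi) (ev_skew r leta lx) (ev_skew r leta rx) in e2.
have {}e2 := etrans (congr1 -%R e2) (opprD _ _); rewrite !opprK in e2.
rewrite ev_ad2_casimir // [in X in _ - X]e2 e1; ring.
Qed.

Lemma casimir_coboundary : nu =1 zinb_cobound dia r -> delta =1 lie_cobound br s.
Proof.
move=> nuE; have [_ nd _ _] := qleib.
have ld : linear delta by move=> a x y; rewrite linearP.
apply: (tensor_ext ld (ad2_linearl s)) => d b.
apply/eqP; rewrite -subr_eq0; apply/eqP.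
apply: (separating_ev2 (separating_oforms B nd)) =>
  _ _ [u [xi [lxi ->]]] [v [eta [leta ->]]].
rewrite (scalarB _ _ (ev_scalar _ _)) -/(dualmul _ _ _ _) deltaE // ev_ad2_casimir //.
rewrite /dualmul !nuE !ev_zinb_cobound //.
(* Invariance lets the coboundary of tau r in the second coefficient be replaced by that of r, which
   is [nu]. *)
have := invariant_ev inv b leta lxi.
rewrite !(scalarB _ _ (ev_scalar _ _)) !ev_tau //;
  try exact: lform_scalar; try exact: rform_scalar.
move=> /eqP; rewrite -subr_eq0 => /eqP e.
rewrite -[RHS](mulr0 (- omega d (m v u))) -e; ring.
Qed.

Lemma ev_cybe (f g h : (D ⊗ B)%type -> K) (t : (D ⊗ B) ⊗ (D ⊗ B)) :
  scalar f -> scalar g -> scalar h ->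
  ev (ev f g) h (tlift (fun ui vi => tlift (fun uj vj =>
    br ui uj ⊗ vi ⊗ vj + ui ⊗ uj ⊗ br vi vj + ui ⊗ br vi uj ⊗ vj) t) t) =
  f (br (rcontr g t) (rcontr h t)) + h (br (lcontr f t) (lcontr g t))
  + g (br (lcontr f t) (rcontr h t)).
Proof.
move=> lf lg lh; rewrite ev_tlift.
have bl (al : (D ⊗ B)%type -> K) : scalar al -> forall z, scalar (fun y => al (br z y)).
  by move=> lal z a x y; rewrite linearPr lal.
have br' (al : (D ⊗ B)%type -> K) : scalar al -> forall z, scalar (fun y => al (br y z)).
  by move=> lal z a x y; rewrite linearPl lal.
rewrite -!(bilin_tlift _ _ _ _ (bl _ lf) (br' _ lf)).
rewrite -!(bilin_tlift _ _ _ _ (bl _ lg) (br' _ lg)).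
rewrite -!(bilin_tlift _ _ _ _ (bl _ lh) (br' _ lh)).
rewrite -!(tliftD (W := K^o)).
apply: (eq_tlift (W := K^o)) => xi1 yi1; rewrite ev_tlift.
rewrite -!(tliftD (W := K^o)).
apply: (eq_tlift (W := K^o)) => xj yj.
rewrite !(scalarD _ _ (ev_scalar _ _)).
rewrite !ev_tens //; try exact: ev_scalar.
rewrite !(linearZl_LR, linearZr_LR) /=
  !(scalar_scale _ _ lf, scalar_scale _ _ lg, scalar_scale _ _ lh).
by ring.
Qed.

Lemma casimir_cybe : zybe dia r -> cybe br s.
Proof.
move=> zr; have [_ nd sym cyc] := qleib.
apply: (separating_ev3 (separating_oforms B nd)).
move=> _ _ _ [u [xi [lxi ->]]] [v [eta [leta ->]]] [w [zeta [lzeta ->]]].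
rewrite ev_cybe; try exact: oform_scalar.
rewrite /s !(rcontr_casimir nd kappaP) // !(lcontr_casimir nd kappaP) //.
rewrite !(bracket_formE _ brE) // !(linearNl, linearNr, linearN) /=.
(* All values of the trilinear form on u, v, w are expressed through [omega u (m v w)] and
   [omega u (m w v)], whose coefficients are the two reduced equations. *)
have E1 : omega (m v w) u = - omega u (m v w) by apply: omega_skew.
have E2 : omega (m w v) u = - omega u (m w v) by apply: omega_skew.
have E3 : omega w (m u v) = - (omega u (m v w) + omega u (m w v)).
  by rewrite (omega_mull qleib) addrC.
have E4 : omega (m u v) w = omega u (m v w) + omega u (m w v).
  by rewrite omega_skew E3 opprK.
have E5 : omega (m v u) w = - omega u (m v w).
  by rewrite omega_skew (omega_mulr qleib).
have E6 : omega (m u w) v = omega u (m v w) + omega u (m w v).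
  by rewrite omega_skew (omega_mulr qleib) E3 opprK.
have E7 : omega (m w u) v = - omega u (m w v).
  by rewrite omega_skew (omega_mulr qleib).
rewrite E1 E2 E4 E5 E6 E7.
have /eqP := zybe_reduced inv zr lxi leta lzeta; rewrite -subr_eq0 => /eqP e1.
have /eqP := zybe_reduced_swap inv zr lxi leta lzeta; rewrite -subr_eq0 => /eqP e2.
have lin (y k1 k2 a b : K) : a = 0 -> b = 0 -> y = k1 * a + k2 * b -> y = 0.
  by move=> -> -> ->; rewrite !mulr0 addr0.
by apply: (lin _ (omega u (m v w)) (omega u (m w v)) _ _ e1 e2); ring.
Qed.

(* The map [f |-> s^sharp f + (tau s)^sharp f] sends [omega_form u ⊗ xi] to
   [- u ⊗ (r - tau r)^sharp xi], so it is onto. *)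
Lemma casimir_factorizable :
  linear_iso (fun xi => sharp r xi - sharp (tau r) xi) ->
  linear_iso (fun f => sharp s f + sharp (tau s) f).
Proof.
have [_ nd _ _] := qleib.
move=> [_ [psi _ psiK]].
set F := fun f => sharp s f + sharp (tau s) f.
have lF : linear F.
  move=> a f g; have ls t : linear (sharp t : 'Hom((D ⊗ B)%type, K^o) -> _).
    apply: linear_tlift => x y c f1 f2.
    by rewrite add_lfunE scale_lfunE scalerDl scalerA.
  by rewrite /F !ls scalerDr addrACA.
split=> //.
pose F' : {linear 'Hom((D ⊗ B)%type, K^o) -> (D ⊗ B)%type} :=
  HB.pack F (GRing.isLinear.Build _ _ _ _ F lF).
have FE f : F f = lcontr f (bullet kappa (r - tau r)).
  by rewrite -(casimir_skew nd kappaP) -/s lcontrD.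
have Fsurj t : t \in limg (linfun F').
  elim/(@tens_ind K D B): t => [|a x y xP yP|d b]; first exact: mem0v.
    by rewrite memvD ?memvZ.
  (* The preimage of d ⊗ b: contraction with [kappa] changes the sign of - d, and [psi] inverts the
     map attached to r - tau r. *)
  have lphi : linear (phi (- d) (psi b) : (D ⊗ B)%type -> K^o) by exact: oform_scalar.
  pose f : {linear (D ⊗ B)%type -> K^o} :=
    HB.pack (phi (- d) (psi b) : (D ⊗ B)%type -> K^o) (GRing.isLinear.Build _ _ _ _ _ lphi).
  have lpsi : scalar (psi b) by move=> a x y; rewrite linearP.
  suff -> : d ⊗ b = linfun F' (linfun f) by apply: memv_img; apply: memvf.
  rewrite lfunE /= FE.
  have -> : lcontr (linfun f) (bullet kappa (r - tau r)) =
            lcontr (phi (- d) (psi b)) (bullet kappa (r - tau r)).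
    by apply: eq_tlift => x y; rewrite lfunE.
  rewrite (lcontr_casimir nd kappaP) // opprK; congr (_ ⊗ _).
  by rewrite lcontrB lcontr_tau // -{1}[b]psiK -[sharp (tau r) _]/(lcontr _ (tau r)) lcontr_tau.
have sF : limg (linfun F') = fullv.
  by apply/eqP; rewrite eqEsubv subvf /=; apply/subvP => t _; apply: Fsurj.
(* A space and its dual have the same dimension, so surjectivity gives injectivity. *)
have kF : lker (linfun F') == 0%VS.
  rewrite -dimv_eq0; have := limg_ker_dim (linfun F') fullv.
  rewrite capfv sF !dimvf.
  move=> /eqP; rewrite -[X in _ == X]add0n.
  have -> : dim 'Hom((D ⊗ B)%type, K^o) = dim (D ⊗ B)%type :> nat by rewrite /dim /= muln1.
  by rewrite eqn_add2r.
exists (linfun F')^-1%VF => x.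
  by rewrite -[F x](lfunE F') lker0_lfunK.
by rewrite -[F _](lfunE F') limg_lfunVK // sF memvf.
Qed.

End RMatrix.

(** * From a quadratic diassociative algebra to a quadratic Leibniz algebra *)

Section LeibnizOfDiassociative.
Variables (K : fieldType) (D : vectType K) (dl dr : {bilinear D -> D -> D}).

(** Loday's Leibniz bracket of a diassociative algebra, in its left version. *)
Definition leibniz_mul (x y : D) : D := dr x y - dl y x.

Lemma leibniz_mul_bilinear : bilinear_for *:%R *:%R leibniz_mul.
Proof.
split=> z a x y; rewrite /leibniz_mul /= !(linearPl, linearPr) scalerBr opprD.
  by rewrite addrACA.
by rewrite addrACA.
Qed.

HB.instance Definition _ :=
  bilinear_isBilinear.Build K D D D *:%R *:%R leibniz_mul leibniz_mul_bilinear.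

Variable omega : {skew_symmetric D}.
Hypothesis quad : quadratic_diassociative dl dr omega.

Lemma leibniz_mul_quadratic : quadratic_leibniz omega leibniz_mul.
Proof.
have [[al ar a1 a2 a3] nd qr ql] := quad.
have qr' x y z : omega (dr x y) z = omega x (dr y z) - omega x (dl y z).
  by rewrite qr omegaBr.
(* [dlE] eliminates ⊣ in favour of ⊢, and [drE] is the vanishing of the cyclic sum of
   [omega z (dr x y)]; both symmetries follow from these. *)
have dlE x y z : omega x (dl y z) = - omega y (dr z x).
  by rewrite -ql -omega_skew.
have drE x y z : omega z (dr x y) = - (omega x (dr y z) + omega y (dr z x)).
  by rewrite omega_skew qr' dlE opprK.
split=> // x y z; rewrite /= /leibniz_mul.
- have [_ sep] := separating_omega nd.
  apply/eqP; rewrite -subr_eq0; apply/eqP; apply: sep => _ [d ->].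
  rewrite /omega_form !(linearBl, linearBr) /= -!(al, ar, a1, a2, a3).
  by rewrite !(omegaBl, omegaDl) !(al, ar, a1, a2, a3) /=; ring.
- by rewrite !omegaBr !dlE; ring.
- rewrite !omegaBr !dlE (drE x y z) (drE z y x); ring.
Qed.

End LeibnizOfDiassociative.

(** * The cobracket in terms of the Leibniz product *)

Section Cobracket.
Variables (K : fieldType) (B D : vectType K) (nu : {linear B -> (B ⊗ B)%type}).
Variables (dl dr : {bilinear D -> D -> D}) (omega : {skew_symmetric D}).

Lemma ev_tensor_form u v (t : D ⊗ D) :
  ev (omega_form omega u) (omega_form omega v) t = tensor_form omega t (u ⊗ v).
Proof.
rewrite /tensor_form; apply: (eq_tlift (W := K^o)) => a b.
rewrite tlift_tens => [//|z c x y|z c x y].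
- by rewrite linearPr mulrDl -mulrA.
- by rewrite linearPr mulrDr mulrCA.
Qed.

(** Tested on u and v, [theta_r] minus the flip of [theta_l] gives [omega d] of u ⊢ v - v ⊣ u, which
    is the Leibniz product; this is the coefficient of [nu], and the other pair gives that of its
    flip. *)
Lemma tensor_cobracket_leibniz (theta_l theta_r : D -> (D ⊗ D)%type) :
  nondegenerate omega -> is_theta omega dl theta_l -> is_theta omega dr theta_r ->
  leibniz_cobracket omega (leibniz_mul dl dr) nu (tensor_cobracket nu theta_l theta_r).
Proof.
move=> nd lP rP.
(* The given theta maps are bare functions; by uniqueness they agree with linear ones, as
   [tensor_cobracketE] requires. *)
have [thl thlP] := theta_exists dl nd; have [thr thrP] := theta_exists dr nd.
move=> u xi v eta d b lxi leta.
have -> : dualmul (tensor_cobracket nu theta_l theta_r)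
    (oform omega u xi) (oform omega v eta) (d ⊗ b) =
  ev (oform omega u xi) (oform omega v eta) (tensor_cobracket nu thl thr (d ⊗ b)).
  congr (ev _ _ _); apply: eq_tlift => d' b'.
  by rewrite (theta_unique nd lP thlP) (theta_unique nd rP thrP).
rewrite tensor_cobracketE !(scalarB _ _ (ev_scalar _ _)) (scalarD _ _ (ev_scalar _ _)).
have of_scalar := omega_form_scalar omega.
rewrite !ev_bullet // !ev_tau // !ev_tensor_form thlP !thrP thlP.
by rewrite /leibniz_mul /= !omegaBr /dualmul; ring.
Qed.

End Cobracket.

Theorem theorem5p6 (K : fieldType) (B D : vectType K)
    (dia : {bilinear B -> B -> B}) (nu : {linear B -> (B ⊗ B)%type})
    (dl dr : {bilinear D -> D -> D}) (omega : {skew_symmetric D})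
    (theta_l theta_r : D -> (D ⊗ D)%type) :
  [pchar K] =i pred0 ->
  zinbiel_bialgebra dia nu ->
  quadratic_diassociative dl dr omega ->
  is_theta omega dl theta_l ->
  is_theta omega dr theta_r ->
  [/\ lie_bialgebra (tensor_bracket dia dl dr)
                    (tensor_cobracket nu theta_l theta_r),
      zinb_quasi_triangular dia nu ->
        lie_quasi_triangular (tensor_bracket dia dl dr)
                             (tensor_cobracket nu theta_l theta_r),
      zinb_triangular dia nu ->
        lie_triangular (tensor_bracket dia dl dr)
                       (tensor_cobracket nu theta_l theta_r)
    & zinb_factorizable dia nu ->
        lie_factorizable (tensor_bracket dia dl dr)
                         (tensor_cobracket nu theta_l theta_r)].
Proof.
move=> char0 bialg quad thl thr.
have qleib := leibniz_mul_quadratic quad.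
have [leib nd _ _] := qleib; have [zinb coz _ _] := bialg.
have brE : leibniz_bracket (leibniz_mul dl dr) dia (tensor_bracket dia dl dr).
  move=> p a q b; apply: (etrans (tensor_bracketE _ _ _ _ _ _ _)); rewrite /= /leibniz_mul.
  have tB x y z : (x - y) ⊗ z = x ⊗ z - y ⊗ z :> (D ⊗ B)%type.
    by rewrite -scaleN1r addrC tens_linearl scaleN1r addrC.
  by rewrite !tB opprB [RHS]addrACA -!addrA; congr (_ + (_ + _)); rewrite addrC.
have deltaE := tensor_cobracket_leibniz nu nd thl thr.
have [kappa kappaP] := casimir_exists nd.
(* The same [bullet kappa r] serves all three special cases. *)
have quasi r : zinb_quasi_triangular_by dia nu r ->
    lie_quasi_triangular_by (tensor_bracket dia dl dr)
      (tensor_cobracket nu theta_l theta_r) (bullet kappa r).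
  move=> [nuE zr inv]; split.
  - exact (casimir_coboundary brE qleib kappaP deltaE inv nuE).
  - exact (casimir_cybe brE qleib kappaP inv zr).
  - exact (casimir_invariant brE qleib kappaP inv).
split.
- split.
  + exact (bracket_lie brE nd leib zinb char0).
  + exact (cobracket_skew deltaE nd).
  + exact (cobracket_jacobi deltaE nd leib coz).
  + exact (cobracket_cocycle brE qleib deltaE bialg).
- by move=> [r qr]; exists (bullet kappa r); apply: quasi.
- move=> [r [nuE zr rs]].
  have inv : zinb_invariant dia (r - tau r).
    by move=> b; rewrite rs subrr /zinb_cobound /tmap !linear0 addr0.
  have [? ? _] := quasi r (And3 nuE zr inv).
  exists (bullet kappa r); split=> //.
  (* Symmetry of r makes [bullet kappa r] skew, since its symmetrization is
     [bullet kappa (r - tau r)]. *)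
  apply/eqP; rewrite -addr_eq0 addrC (casimir_skew nd kappaP) rs subrr.
  by rewrite bullet0.
- move=> [r qr iso]; exists (bullet kappa r); first exact: quasi.
  exact (casimir_factorizable qleib kappaP iso).
Qed.
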